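(* Let $G$ be a finitely generated nilpotent group and $\pi$ an irreducible (possibly infinite-dimensional) representation of $G$ over an algebraically closed field $K$ such that $\pi$ has finite weight. Then $\pi$ is monomial.
   Context: Representations are on $K$-vector spaces without any topological structure. A character of a group $H$ is a homomorphism $\chi\colon H\to K^*$, also regarded as a one-dimensional representation over $K$. Finitely induced representation: for a subgroup $H\subset G$ and a representation $\rho$ of $H$ on a $K$-vector space $V$, $\operatorname{ind}_H^G(\rho)$ is the space of all functions $f\colon G\to V$ such that $f(hg)=\rho(h)f(g)$ for all $h\in H$, $g\in G$, and such that the support of $f$ is a union of finitely many right cosets $Hg$; $G$ acts by right translations, $(g_0f)(x)=f(xg_0)$. The representation $\pi$ has finite weight if there are a subgroup $H\subset G$ and a character $\chi$ of $H$ such that the vector space $\operatorname{Hom}_H(\chi,\pi|_H)$ is non-zero and finite-dimensional. The representation $\pi$ is monomial if there are a subgroup $H\subset G$ and a character $\chi$ of $H$ such that $\pi\simeq\operatorname{ind}_H^G(\chi)$. *)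

(* Defs.v *)
From HB Require Import structures.
From mathcomp Require Import all_boot all_order all_algebra.
From mathcomp Require Import boolp classical_sets functions.

Set Implicit Arguments.
Unset Strict Implicit.
Unset Printing Implicit Defensive.

Import GRing.Theory.
Local Open Scope classical_set_scope.
Local Open Scope ring_scope.

(* Subgroups of a group G are elements of the library type groupClosed G.
   Membership is boolean; classically these are all the subgroups. *)

Section Groups.
Variable G : groupType.

Inductive generated (A : set G) : set G :=
| generated_in x of A x : generated A x
| generated_1 : generated A 1%g
| generated_M x y of generated A x & generated A y : generated A (x * y)%g
| generated_V x of generated A x : generated A (x^-1)%g.

Definition finitely_generated : Prop :=
  exists s : seq G, generated [set` s] = setT.

Fixpoint lower_central (n : nat) : set G :=
  if n is m.+1 then
    generated [set [~ x, y]%g | x in lower_central m & y in setT]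
  else setT.

Definition nilpotent_group : Prop :=
  exists n, lower_central n = [set 1%g].

End Groups.

Section VectorSpaces.
Variables (K : fieldType) (L : lmodType K).

Definition nonzero_space : Prop := exists v : L, v != 0.

Definition finite_dimensional : Prop :=
  exists n (e : 'I_n -> L),
    forall v, exists c : 'I_n -> K, v = \sum_(i < n) c i *: e i.

End VectorSpaces.

Section Representations.
Variables (K : fieldType) (G : groupType).

(* As for mx_representation in the library, a representation (or a character)
   of a subgroup H is a total function on G of which only the values on H are
   constrained and used. The group G itself is the case H = predT. *)

Definition is_repr (H : {pred G}) (V : lmodType K) (rho : G -> V -> V) : Prop :=
  [/\ {in H, forall g, linear (rho g)},
      forall v, rho 1%g v = v
    & {in H &, forall g h, forall v, rho (g * h)%g v = rho g (rho h v)}].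

Record representation (H : {pred G}) (V : lmodType K) := Representation {
  repr_fun :> G -> V -> V;
  reprP : is_repr H repr_fun }.

Lemma repr0 (H : {pred G}) (V : lmodType K) (rho : representation H V) h :
  h \in H -> rho h 0 = 0.
Proof.
case: (reprP rho) => lin _ _ /lin l.
by have := l (-1) 0 0; rewrite scaler0 addr0 scaleN1r addNr.
Qed.

Lemma res_subproof (H : {pred G}) (V : lmodType K)
  (pi : representation predT V) : is_repr H pi.
Proof.
case: (reprP pi) => lin one mul.
by split=> // [g _ | g h _ _]; [exact: lin | exact: mul].
Qed.

Definition res (H : {pred G}) (V : lmodType K)
  (pi : representation predT V) : representation H V :=
  Representation (@res_subproof H V pi).

Definition irreducible_repr (V : lmodType K) (pi : representation predT V) :
    Prop :=
  nonzero_space V /\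
  forall W : submodClosed V,
    (forall g, {in W, forall w, pi g w \in W}) ->
    {in W, forall w, w = 0} \/ forall v, v \in W.

Definition is_character (H : {pred G}) (chi : G -> K) : Prop :=
  [/\ {in H, forall h, chi h != 0}, chi 1%g = 1
    & {in H &, {morph chi : g h / (g * h)%g >-> g * h}}].

Record character (H : {pred G}) := Character {
  char_fun :> G -> K;
  characterP : is_character H char_fun }.

Definition char_act (H : {pred G}) (chi : character H) (g : G) (a : K^o) : K^o :=
  chi g * a.

Lemma char_subproof (H : {pred G}) (chi : character H) :
  is_repr H (char_act chi).
Proof.
case: (characterP chi) => _ one mul; rewrite /char_act; split.
- by move=> g _ k u v; rewrite mulrDr /GRing.scale /= mulrCA.
- by move=> v; rewrite one mul1r.
- by move=> g h Hg Hh v; rewrite mul // mulrA.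
Qed.

Definition char_repr (H : {pred G}) (chi : character H) :
  representation H K^o := Representation (char_subproof chi).

Section Hom.
Variables (H : {pred G}) (U V : lmodType K).
Variables (rho : representation H U) (sigma : representation H V).

Definition hom_pred : {pred U -> V} := [pred phi : U -> V |
  `[< linear phi /\
      {in H, forall h, forall u, phi (rho h u) = sigma h (phi u)} >] ].

Lemma hom_closed : submod_closed hom_pred.
Proof.
case: (reprP sigma) => lin _ _.
split.
  apply/asboolP; split=> [k u v|h Hh u] /=; first by rewrite scaler0 addr0.
  by rewrite (repr0 sigma Hh).
move=> k f g /asboolP[lf ef] /asboolP[lg eg]; apply/asboolP; split.
  move=> a u v; rewrite !fctE lf lg !scalerDr !scalerA (mulrC k a).
  by rewrite addrACA.
by move=> h Hh u; rewrite !fctE ef // eg // (lin _ Hh).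
Qed.

HB.instance Definition _ :=
  GRing.isSubmodClosed.Build K (U -> V) hom_pred hom_closed.

(* Hom_H(rho, sigma), as a subspace of the space of functions U -> V. *)
Record hom_space := HomSpace {
  hom_fun :> U -> V;
  hom_funP : hom_fun \in hom_pred }.

HB.instance Definition _ := [isSub for hom_fun].
HB.instance Definition _ := [Choice of hom_space by <:].
HB.instance Definition _ := [SubChoice_isSubLmodule of hom_space by <:].

Definition isomorphic : Prop := exists phi : hom_space, bijective phi.

End Hom.

Section Induction.
Variables (H : groupClosed G) (V : lmodType K) (rho : representation H V).

(* The right coset of t is the set of all g such that g * t^-1 is in H. *)
Definition ind_pred : {pred G -> V} := [pred f : G -> V |
  `[< {in H, forall h, forall g, f (h * g)%g = rho h (f g)} /\
      exists s : seq G,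
        forall g, f g != 0 <-> exists2 t, t \in s & (g * t^-1)%g \in H >] ].

Lemma repr_eq0 h v : h \in H -> rho h v = 0 -> v = 0.
Proof.
case: (reprP rho) => lin one mul Hh e.
have Hi : h^-1%g \in H by rewrite gpredV.
by rewrite -(one v) -(mulVg h) mul // e (repr0 rho Hi).
Qed.

Lemma ind_predP (f : G -> V) (s : seq G) :
    {in H, forall h, forall g, f (h * g)%g = rho h (f g)} ->
    (forall g, f g != 0 -> exists2 t, t \in s & (g * t^-1)%g \in H) ->
  f \in ind_pred.
Proof.
move=> ef sf; apply/asboolP; split=> //.
exists [seq t <- s | f t != 0] => g; split.
  move=> fg; have [t ts Ht] := sf g fg; exists t => //.
  rewrite mem_filter ts andbT; apply: contra fg => /eqP ft.
  by rewrite -(mulgVK t g) (ef _ Ht) ft (repr0 rho Ht).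
case=> t; rewrite mem_filter => /andP[ft ts] Ht; apply: contra ft => /eqP fg.
by apply/eqP/(repr_eq0 Ht); rewrite -ef // mulgVK.
Qed.

Lemma ind_closed : submod_closed ind_pred.
Proof.
case: (reprP rho) => lin _ _.
split.
  apply: (@ind_predP _ [::]) => [h Hh g|g /eqP//].
  by rewrite (repr0 rho Hh).
move=> k f g /asboolP[ef [sf Pf]] /asboolP[eg [sg Pg]].
apply: (@ind_predP _ (sf ++ sg)) => [h Hh x|x].
  by rewrite !fctE ef // eg // (lin _ Hh).
rewrite !fctE; have [->|/Pf[t ts Ht] _] := eqVneq (f x) 0; last first.
  by exists t => //; rewrite mem_cat ts.
rewrite scaler0 add0r => /Pg[t ts Ht].
by exists t => //; rewrite mem_cat ts orbT.
Qed.

HB.instance Definition _ :=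
  GRing.isSubmodClosed.Build K (G -> V) ind_pred ind_closed.

Record ind_space := IndSpace {
  ind_fun :> G -> V;
  ind_funP : ind_fun \in ind_pred }.

HB.instance Definition _ := [isSub for ind_fun].
HB.instance Definition _ := [Choice of ind_space by <:].
HB.instance Definition _ := [SubChoice_isSubLmodule of ind_space by <:].

Lemma ind_act_subproof (g : G) (f : ind_space) :
  (fun x => f (x * g)%g) \in ind_pred.
Proof.
have /asboolP[ef [s Ps]] := ind_funP f.
apply: (@ind_predP _ [seq (t * g^-1)%g | t <- s]) => [h Hh x|x].
  by rewrite -mulgA (ef _ Hh).
move=> /Ps[t ts Ht]; exists (t * g^-1)%g; first exact: map_f.
by rewrite invgM invgK mulgA.
Qed.

Definition ind_act (g : G) (f : ind_space) : ind_space :=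
  IndSpace (ind_act_subproof g f).

Lemma ind_subproof : is_repr predT ind_act.
Proof.
split=> [g _ k u v|f|g h _ _ f]; apply/val_inj/funext => x /=.
- by [].
- by rewrite mulg1.
- by rewrite mulgA.
Qed.

Definition ind : representation predT ind_space := Representation ind_subproof.

End Induction.

Definition finite_weight (V : lmodType K) (pi : representation predT V) : Prop :=
  exists (H : groupClosed G) (chi : character H),
    nonzero_space (hom_space (char_repr chi) (res H pi)) /\
    finite_dimensional (hom_space (char_repr chi) (res H pi)).

Definition monomial_repr (V : lmodType K) (pi : representation predT V) : Prop :=
  exists (H : groupClosed G) (chi : character H),
    isomorphic pi (ind (char_repr chi)).

End Representations.

(* Main.v *)
Require Import Defs.
From HB Require Import structures.
From mathcomp Require Import all_boot all_order all_algebra.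
From mathcomp Require Import boolp classical_sets functions.

(* Call a pair (H, W) of a subgroup H and a finite-dimensional irreducible
   H-stable subspace W of V a finite weight pair if the H-subspaces isomorphic
   to W all lie in one finite-dimensional subspace. A weight space supplies such
   a pair, and since G is noetherian H may be taken maximal. Maximality forces
   y in H as soon as y normalizes H and some positive power of y carries W to an
   isomorphic H-subspace; by nilpotency H is then isolated (x^m in H implies x
   in H).

   Climb from H to G by successive normalizers N. If the span M of the N-translates
   of W is irreducible and is the direct sum of these translates, Clifford theory
   extends this to the normalizer of N, provided that gM is not isomorphic to M
   for g outside N normalizing N. An isomorphism gM -> M carries gW to a
   finite-dimensional subspace of the direct sum M; hence the elements of some
   n^-1 (g H g^-1) n with n in N have powers in H, so n^-1 g normalizes H and
   moves W to an isomorphic copy, which maximality excludes. Thus V is induced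
   from (H, W). Finally W itself is induced from a line: a nonscalar element that
   is central modulo scalars has an eigenspace from which Clifford theory
   induces W, and the dimension drops. *)

Set Implicit Arguments.
Unset Strict Implicit.
Unset Printing Implicit Defensive.

Import GRing.Theory.
Local Open Scope classical_set_scope.

(** * Nilpotent groups *)

Ltac gsimp := rewrite ?(mulgA, invgM, invgK, mulgK, mulgVK, mulVg, mulgV,
  mulg1, mul1g, invg1)%g.

Section Subgroups.
Variable G : groupType.
Implicit Types (A B C H P S T : set G) (x y z g : G).
Local Open Scope group_scope.

Definition subgroup A :=
  [/\ A 1, forall x y, A x -> A y -> A (x * y) & forall x, A x -> A x^-1].

(** An equivalence, not one implication: an infinite subgroup can be conjugated into a proper part
    of itself, and elements doing so would not form a subgroup. *)
Definition normalizer A g := forall x, A (x ^ g) <-> A x.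

Lemma subgroup1 A : subgroup A -> A 1. Proof. by case. Qed.
Lemma subgroupM A x y : subgroup A -> A x -> A y -> A (x * y).
Proof. by case=> _ h _; exact: h. Qed.
Lemma subgroupV A x : subgroup A -> A x -> A x^-1.
Proof. by case=> _ _; exact. Qed.
Lemma subgroupVE A x : subgroup A -> A x^-1 -> A x.
Proof. by move=> sA /(subgroupV sA); rewrite invgK. Qed.
Lemma subgroupX A x n : subgroup A -> A x -> A (x ^+ n).
Proof.
move=> sA Ax; elim: n => [|n IH]; first by rewrite expg0; exact: subgroup1.
by rewrite expgS; exact: subgroupM.
Qed.
Lemma subgroupJ A x y : subgroup A -> A x -> A y -> A (x ^ y).
Proof.
by move=> sA Ax Ay; rewrite conjgE; do ?apply: subgroupM => //; exact: subgroupV.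
Qed.
Lemma subgroupR A x y : subgroup A -> A x -> A y -> A [~ x, y].
Proof.
move=> sA Ax Ay; rewrite commgEl; apply: subgroupM => //; first exact: subgroupV.
exact: subgroupJ.
Qed.
Lemma subgroupMl A x y : subgroup A -> A x -> A (x * y) -> A y.
Proof.
by move=> sA Ax Axy; rewrite -(mulKg x y); apply: subgroupM => //; exact: subgroupV.
Qed.
Lemma subgroupMr A x y : subgroup A -> A y -> A (x * y) -> A x.
Proof.
by move=> sA Ay Axy; rewrite -(mulgK y x); apply: subgroupM => //; exact: subgroupV.
Qed.

Lemma subgroupT : subgroup setT. Proof. by []. Qed.

Lemma subgroup_generated A : subgroup (generated A).
Proof.
by split; [exact: generated_1 | exact: generated_M | exact: generated_V].
Qed.

Lemma generated_min A B : subgroup B -> A `<=` B -> generated A `<=` B.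
Proof.
move=> sB AB x; elim=> {x} [x /AB//||x y _ Bx _ By|x _ Bx].
- exact: subgroup1.
- exact: subgroupM.
- exact: subgroupV.
Qed.

Lemma subset_generated A : A `<=` generated A.
Proof. exact: generated_in. Qed.

Lemma generated_mono A B : A `<=` B -> generated A `<=` generated B.
Proof.
move=> AB; apply: generated_min; first exact: subgroup_generated.
by move=> x /AB; exact: subset_generated.
Qed.

Lemma subgroup_normalizer A : subgroup (normalizer A).
Proof.
split=> [x|x y Nx Ny z|x Nx z]; first by rewrite conjg1.
  by rewrite conjgM; split => [/Ny/Nx|/Nx/Ny].
by rewrite -[in X in _ <-> X](conjgKV x z); split=> /Nx.
Qed.

Lemma sub_normalizer A : subgroup A -> A `<=` normalizer A.
Proof.
move=> sA x Ax y; split=> [h|Ay]; last exact: subgroupJ.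
by rewrite -(conjgK x y); apply: subgroupJ => //; exact: subgroupV.
Qed.

Lemma subgroup_conj A g : subgroup A -> subgroup [set x | A (x ^ g)].
Proof.
move=> sA; split=> /= [|x y Ax Ay|x Ax].
- by rewrite conj1g; exact: subgroup1.
- by rewrite conjMg; exact: subgroupM.
- by rewrite conjVg; exact: subgroupV.
Qed.

(** The product [a ^+ k * a ^- l] encodes an arbitrary integer power of [a] with natural
    exponents. *)
Lemma generated_adjoin P a z : subgroup P -> normalizer P a ->
  generated (P `|` [set a]) z ->
  exists k l p, P p /\ z = a ^+ k * a ^- l * p.
Proof.
move=> sP Na; pose D := [set z | exists k l p, P p /\ z = a ^+ k * a ^- l * p].
have NX n : normalizer P (a ^+ n).
  exact: (subgroupX n (subgroup_normalizer P) Na).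
have NXV n : normalizer P (a ^- n).
  exact: (subgroupV (subgroup_normalizer P) (NX n)).
have cXV k l : a ^- l * a ^+ k = a ^+ k * a ^- l.
  by apply/commute_sym/commuteV/commuteX2.
have DP p : P p -> D p by exists 0%N, 0%N, p; rewrite expg0 invg1 mulg1 mul1g.
suff: generated (P `|` [set a]) `<=` D by apply.
apply: generated_min; last first.
  move=> x [/DP//|->]; exists 1%N, 0%N, 1; split; first exact: subgroup1.
  by rewrite invg1 !mulg1.
split; first exact: DP (subgroup1 sP).
  move=> _ _ [k [l [p [Pp ->]]]] [k' [l' [p' [Pp' ->]]]].
  exists (k + k')%N, (l + l')%N, (p ^ (a ^+ k' * a ^- l') * p'); split.
    by apply: subgroupM => //; rewrite conjgM; apply/NXV/NX/Pp.
  rewrite conjgE (addnC l) !expgnDr !invgM invgK !mulgA; do 4 congr (_ * _).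
  by gsimp; rewrite -(mulgA (a ^+ k)) -(cXV k' l); gsimp.
move=> _ [k [l [p [Pp ->]]]].
exists l, k, (p^-1 ^ (a ^+ l * a ^- k)); split.
  by rewrite conjgM; apply/NXV/NX; exact: subgroupV.
by rewrite conjgE; gsimp.
Qed.

(** * Noetherian groups *)

Definition noetherian P :=
  forall A, subgroup A -> A `<=` P -> exists s : seq G, A = generated [set` s].

(** The exponents of [a] modulo [P] occurring in [A] are multiples of the least positive one [d], so
    one element [a ^+ d * q] of [A] together with generators of [A] intersected with [P] generates
    [A]. *)
Lemma noetherian_adjoin P a : subgroup P -> normalizer P a -> noetherian P ->
  noetherian (generated (P `|` [set a])).
Proof.
move=> sP Na noeP A sA AQ.
have NX n : normalizer P (a ^+ n).
  exact: (subgroupX n (subgroup_normalizer P) Na).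
have [|s As] := noeP (A `&` P) _ (@subIsetr _ A P).
  split=> [|x y [Ax Px] [Ay Py]|x [Ax Px]]; split.
  - exact: subgroup1.
  - exact: subgroup1.
  - exact: subgroupM.
  - exact: subgroupM.
  - exact: subgroupV.
  - exact: subgroupV.
have shape z : A z -> exists n p, P p /\ (z = a ^+ n * p \/ z^-1 = a ^+ n * p).
  move=> /AQ/(generated_adjoin sP Na)[k [l [p [Pp ->]]]].
  have [lk|/ltnW kl] := leqP l k.
    by exists (k - l)%N, p; split=> //; left; rewrite expgnFr.
  exists (l - k)%N, (p^-1 ^ (a ^+ l * a ^- k)); split.
    have Nu : normalizer P (a ^+ l * a ^- k).
      have sN := subgroup_normalizer P.
      exact: (subgroupM sN (NX l) (subgroupV sN (NX k))).
    by apply/Nu; exact: subgroupV.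
  by right; rewrite expgnFr // conjgE; gsimp.
pose D := [set n | (0 < n)%N /\ exists2 p, P p & A (a ^+ n * p)].
have As' : [set` s] `<=` A.
  by move=> x xs; have [] : (A `&` P) x by rewrite As; exact: generated_in.
have inAP z : A z -> P z -> generated [set` s] z by rewrite -As.
(* If no positive exponent occurs, then [A] lies in [P] and generators of the intersection
   suffice. *)
have [[d0 Dd0]|D0] := pselect (exists d, D d); last first.
  exists s; apply/seteqP; split; last exact: generated_min.
  have zero n p : P p -> A (a ^+ n * p) -> n = 0%N.
    case: n => // n Pp Anp; case: D0; exists n.+1; split => //; by exists p.
  move=> z Az; apply: inAP => //.
  have [n [p [Pp [zE|zE]]]] := shape z Az.
    by rewrite zE (zero n p) // -?zE // expg0 mul1g.
  apply: (subgroupVE sP); rewrite zE (zero n p) // -?zE ?expg0 ?mul1g //.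
  exact: subgroupV.
have exD : exists n, `[< D n >] by exists d0; apply/asboolP.
case: (ex_minnP exD) => d /asboolP[d_gt0 [q Pq Aq]] dmin.
exists (a ^+ d * q :: s); set B := generated _.
have sB : subgroup B by exact: subgroup_generated.
have Bs : generated [set` s] `<=` B.
  apply: generated_mono => x xs /=.
  by rewrite inE; apply/orP; right.
have Bq : B (a ^+ d * q) by apply: generated_in; rewrite /= inE eqxx.
apply/seteqP; split; last first.
  apply: generated_min => // x /=; rewrite inE => /orP[/eqP->//|].
  exact: As'.
(* Division by [d]: split off one factor [a ^+ d * q] as long as the exponent is at least [d]; below
   [d] it must be 0 by minimality. *)
have pos n p : P p -> A (a ^+ n * p) -> B (a ^+ n * p).
  elim/ltn_ind: n p => n IH p Pp Anp; have [nd|dn] := ltnP n d.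
    case: n nd Anp {IH} => [_|n nd] Anp.
      by apply/Bs/inAP => //; rewrite expg0 mul1g.
    suff /dmin : `[< D n.+1 >] by rewrite leqNgt nd.
    by apply/asboolP; split => //; exists p.
  have E : a ^+ n * p =
      a ^+ d * q * (a ^+ (n - d) * (q^-1 ^ (a ^+ (n - d)) * p)).
    by rewrite conjgE -{1}(subnKC dn) expgnDr; gsimp.
  have Pp' : P (q^-1 ^ (a ^+ (n - d)) * p).
    by apply: subgroupM => //; apply/NX; exact: subgroupV.
  rewrite E; apply: subgroupM => //; apply: IH => //.
    by rewrite ltn_subrL d_gt0 (leq_trans d_gt0 dn).
  by move: Anp; rewrite E; exact: subgroupMl.
move=> z Az; have [n [p [Pp [zE|zE]]]] := shape z Az.
  by rewrite zE; apply: pos => //; rewrite -zE.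
by apply: (subgroupVE sB); rewrite zE; apply: pos => //; rewrite -zE; exact: subgroupV.
Qed.

(** Without a maximal member, choice produces a strictly increasing sequence in [F]. Its union is a
    finitely generated subgroup, and the generators already lie in one term, so the sequence stops
    there. *)
Lemma noetherian_max (F : set (set G)) : noetherian setT ->
  (forall A, F A -> subgroup A) -> (exists A, F A) ->
  exists2 A, F A & forall B, F B -> A `<=` B -> B `<=` A.
Proof.
move=> noeG sF [A0 FA0]; apply: contrapT => nomax.
have next (A : {A | F A}) : exists B : {B | F B}, proj1_sig A `<` proj1_sig B.
  apply: contrapT => nB; apply: nomax; exists (proj1_sig A); first exact: proj2_sig.
  move=> B FB AB; apply: contrapT => nBA; apply: nB.
  by exists (exist _ B FB); split.
have [f fP] := choice next.
pose u n := proj1_sig (iter n f (exist _ A0 FA0)).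
have su n : subgroup (u n) by apply: sF; exact: proj2_sig.
have umono m n : (m <= n)%N -> u m `<=` u n.
  elim: n => [|n IH]; first by rewrite leqn0 => /eqP ->.
  rewrite leq_eqVlt => /orP[/eqP->//|/IH h].
  by apply: (subset_trans h); case: (fP (iter n f (exist _ A0 FA0))).
pose U := \bigcup_n u n.
have sU : subgroup U.
  split; first by exists 0%N => //; exact: subgroup1.
    move=> x y [m _ um] [n _ un]; exists (maxn m n) => //.
    apply: subgroupM => //; [move: um|move: un]; apply: umono.
      exact: leq_maxl.
    exact: leq_maxr.
  by move=> x [n _ un]; exists n => //; exact: subgroupV.
have [s Us] := noeG U sU (fun _ _ => I).
have [n sn] : exists n, [set` s] `<=` u n.
  have : [set` s] `<=` U by rewrite Us; exact: subset_generated.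
  elim: s {Us} => [_|x s IH sU']; first by exists 0%N.
  have [n1 _ un1] := sU' x (mem_head x s).
  have [|n2 un2] := IH; first by move=> y ys; apply: sU'; rewrite /= inE orbC ys.
  exists (maxn n1 n2) => y /=; rewrite inE => /orP[/eqP->|/un2].
    exact: umono (leq_maxl _ _) _ un1.
  exact: umono (leq_maxr _ _) _.
have [_] := fP (iter n f (exist _ A0 FA0)); apply.
apply: (@subset_trans _ U).
  by move=> x ux; exists n.+1.
by rewrite Us; exact: (generated_min (su n) sn).
Qed.

(** * Commutators and the lower central series of a subgroup *)

Lemma commgM x y z : [~ x, y * z] = [~ x, z] * [~ x, y] ^ z.
Proof. by rewrite !commgEl !conjgE; gsimp. Qed.

Lemma commMg x y z : [~ x * y, z] = [~ x, z] ^ y * [~ y, z].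
Proof. by rewrite !commgEl !conjgE; gsimp. Qed.

Lemma conjg_commg x y : x ^ y = x * [~ x, y].
Proof. by rewrite commgEl mulVKg. Qed.

Lemma sub_normalizerP A B : subgroup B ->
  (forall x y, A x -> B y -> B (y ^ x)) -> subgroup A -> A `<=` normalizer B.
Proof.
move=> sB AB sA x Ax y; split => [Byx|]; last exact: AB.
by rewrite -(conjgK x y); apply: AB => //; exact: subgroupV.
Qed.

Fixpoint lower_central_of A n :=
  if n is m.+1 then
    generated [set [~ x, y] | x in lower_central_of A m & y in A]
  else A.

Lemma lower_central_of_mono A B n :
  A `<=` B -> lower_central_of A n `<=` lower_central_of B n.
Proof.
move=> AB; elim: n => [|n IH] //=; apply: generated_mono => _ [x Ax [y Ay <-]].
by exists x; [exact: IH|exists y => //; exact: AB].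
Qed.

Lemma lower_central_ofT n : lower_central_of setT n = lower_central n.
Proof. by elim: n => [|n IH] //=; rewrite IH. Qed.

Section LowerCentralSeries.
Variables (A : set G) (sA : subgroup A).
Local Notation L := (lower_central_of A).

Lemma subgroup_lower_central_of n : subgroup (L n).
Proof. by case: n => [|n] //=; exact: subgroup_generated. Qed.
Local Notation sL := subgroup_lower_central_of.

Lemma lower_central_of_comm n x y : L n x -> A y -> L n.+1 [~ x, y].
Proof. by move=> Lx Ay; apply: generated_in; exists x => //; exists y. Qed.

Lemma lower_central_of_decr n : L n.+1 `<=` L n.
Proof.
elim: n => [|n IH].
  by apply: generated_min => // _ [x Ax [y Ay <-]]; exact: subgroupR.
apply: generated_min; first exact: sL.
by move=> _ [x Lx [y Ay <-]]; apply: lower_central_of_comm => //; exact: IH.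
Qed.

Lemma lower_central_of_sub n : L n `<=` A.
Proof.
by elim: n => [|n IH] //; apply: subset_trans IH; exact: lower_central_of_decr.
Qed.

Lemma lower_central_of_normal n : A `<=` normalizer (L n).
Proof.
apply: sub_normalizerP => //; first exact: sL.
move=> x y Ax Ly; rewrite conjg_commg; apply: (subgroupM (sL n)) => //.
by apply: lower_central_of_decr; exact: lower_central_of_comm.
Qed.

(** Modulo [L n.+2] the commutator is bilinear on [L n] and [A], so [L n.+1] is generated there by
    commutators of generators. In the proof [BJ] absorbs the conjugations in the commutator
    identities. *)
Lemma lower_central_of_generated n S T : A = generated S -> T `<=` L n ->
  L n `<=` generated (T `|` L n.+1) ->
  L n.+1 `<=` generated ([set [~ t, s] | t in T & s in S] `|` L n.+2).
Proof.
move=> AS TL LT; set B := generated (_ `|` L n.+2).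
have sB : subgroup B by exact: subgroup_generated.
have BJ x y z : L n x -> A y -> A z -> B [~ x, y] -> B ([~ x, y] ^ z).
  move=> Lx Ay Az Bxy; rewrite conjg_commg; apply: (subgroupM sB) => //.
  apply: generated_in; right; apply: lower_central_of_comm => //.
  exact: lower_central_of_comm.
have BVr x y : L n x -> A y -> B [~ x, y] -> B [~ x, y^-1].
  move=> Lx Ay Bxy; have := commg1 x; rewrite -{1}(mulgV y) commgM => /mulg1_eq E.
  by apply: (subgroupVE sB); rewrite E; apply: BJ => //; exact: subgroupV.
have BVl x y : L n x -> A y -> B [~ x, y] -> B [~ x^-1, y].
  move=> Lx Ay Bxy; have := comm1g y; rewrite -{1}(mulgV x) commMg => /mulg1_eq <-.
  apply/(subgroupV sB)/BJ => //.
  by apply: (subgroupV sA); apply: lower_central_of_sub Lx.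
have BT t y : T t -> A y -> B [~ t, y].
  move=> Tt; rewrite AS => gy; suff [] : A y /\ B [~ t, y] by [].
  elim: gy => {y} [s Ss||x y _ [Ax Bx] _ [Ay By]|x _ [Ax Bx]].
  - split; first by rewrite AS; exact: generated_in.
    by apply: generated_in; left; exists t => //; exists s.
  - by rewrite commg1; split; exact: subgroup1.
  - split; first exact: subgroupM.
    rewrite commgM; apply: (subgroupM sB) => //.
    by apply: BJ => //; exact: TL.
  - split; first exact: subgroupV.
    by apply: BVr => //; exact: TL.
apply: generated_min => // _ [x /LT gx [y Ay <-]].
suff [] : L n x /\ B [~ x, y] by [].
elim: gx => {x} [x [Tx|Lx]||x z _ [Lx Bx] _ [Lz Bz]|x _ [Lx Bx]].
- by split; [exact: TL|exact: BT].
- split; first exact: lower_central_of_decr.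
  by apply: generated_in; right; exact: lower_central_of_comm.
- by rewrite comm1g; split; [apply: subgroup1; exact: sL|exact: subgroup1].
- split; first by apply: subgroupM => //; exact: sL.
  rewrite commMg; apply: (subgroupM sB) => //; apply: BJ => //.
  exact: lower_central_of_sub Lz.
- by split; [apply: subgroupV => //; exact: sL|exact: BVl].
Qed.

End LowerCentralSeries.

(** * Calculation modulo a normalized subgroup *)

Section Congruence.
Variables (A C : set G).
Hypotheses (sA : subgroup A) (sC : subgroup C) (AC : A `<=` normalizer C).

Definition congr_mod x y := C (x^-1 * y).
Local Notation "x ~ y" := (congr_mod x y) (at level 70).

Lemma congr_mod_refl x : x ~ x.
Proof. by rewrite /congr_mod mulVg; exact: subgroup1. Qed.

Lemma congr_mod_sym x y : x ~ y -> y ~ x.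
Proof. by move=> xy; apply: (subgroupVE sC); rewrite invgM invgK. Qed.

Lemma congr_mod_trans y x z : x ~ y -> y ~ z -> x ~ z.
Proof.
by move=> xy yz; have := subgroupM sC xy yz; rewrite !mulgA mulgK.
Qed.

Lemma congr_modM x x' y y' : A y -> x ~ x' -> y ~ y' -> x * y ~ x' * y'.
Proof.
move=> Ay xx yy; have := subgroupM sC ((AC Ay (x^-1 * x')).2 xx) yy.
by rewrite /congr_mod conjgE; gsimp.
Qed.

Lemma congr_modX x y n : A x -> x ~ y -> x ^+ n ~ y ^+ n.
Proof.
move=> Ax xy; elim: n => [|n IH]; first by rewrite !expg0; exact: congr_mod_refl.
by rewrite !expgS; apply: congr_modM => //; exact: subgroupX.
Qed.

Lemma congr_mod_comm x y : C [~ x, y] -> x * y ~ y * x.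
Proof.
move=> Cxy; apply: congr_mod_sym; rewrite /congr_mod invgM.
by move: Cxy; rewrite commgEl conjgE !mulgA.
Qed.

Lemma congr_mod_commX x y n : A x -> A y -> C [~ x, y] -> x ^+ n * y ~ y * x ^+ n.
Proof.
move=> Ax Ay Cxy; elim: n => [|n IH].
  by rewrite expg0 mul1g mulg1; exact: congr_mod_refl.
rewrite expgS -mulgA.
apply: (congr_mod_trans (y := x * (y * x ^+ n))).
  apply: congr_modM => //; last exact: congr_mod_refl.
  by apply: subgroupM => //; exact: subgroupX.
rewrite !mulgA; apply: congr_modM.
- exact: subgroupX.
- exact: congr_mod_comm.
- exact: congr_mod_refl.
Qed.

Lemma congr_modXM x y n : A x -> A y -> C [~ x, y] ->
  (x * y) ^+ n ~ x ^+ n * y ^+ n.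
Proof.
move=> Ax Ay Cxy; elim: n => [|n IH].
  by rewrite !expg0 mul1g; exact: congr_mod_refl.
rewrite expgS; apply: (congr_mod_trans (y := x * y * (x ^+ n * y ^+ n))).
  apply: congr_modM => //; last exact: congr_mod_refl.
  by apply: subgroupX => //; exact: subgroupM.
rewrite [x ^+ n.+1]expgS [y ^+ n.+1]expgS -!mulgA; apply: congr_modM => //.
- by do ?[apply: subgroupM|apply: subgroupX].
- exact: congr_mod_refl.
rewrite !mulgA; apply: congr_modM; first exact: subgroupX.
  by apply/congr_mod_sym/congr_mod_commX.
exact: congr_mod_refl.
Qed.

Lemma congr_mod_conj x y : C [~ x, y] -> x ^ y ~ x.
Proof.
by move=> Cxy; apply: congr_mod_sym; rewrite conjg_commg /congr_mod mulKg.
Qed.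

Lemma congr_mod_commXg x y n : A x -> A y -> (forall a, A a -> C [~ [~ x, y], a]) ->
  [~ x ^+ n, y] ~ [~ x, y] ^+ n.
Proof.
move=> Ax Ay cen; elim: n => [|n IH].
  by rewrite !expg0 comm1g; exact: congr_mod_refl.
rewrite !expgS commMg; apply: congr_modM => //.
  by apply: subgroupR => //; exact: subgroupX.
by apply/congr_mod_conj/cen; exact: subgroupX.
Qed.

Lemma congr_mod_commgX x y n : A x -> A y -> (forall a, A a -> C [~ [~ x, y], a]) ->
  [~ x, y ^+ n] ~ [~ x, y] ^+ n.
Proof.
move=> Ax Ay cen; elim: n => [|n IH].
  by rewrite !expg0 commg1; exact: congr_mod_refl.
rewrite expgS expgSr commgM; apply: congr_modM => //.
  by apply: subgroupJ => //; [exact: subgroupR|exact: subgroupX].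
by apply/congr_mod_conj/cen; exact: subgroupX.
Qed.

End Congruence.

Section Nilpotent.
Hypothesis nilG : nilpotent_group G.

Lemma nilpotent_lower_central_of A : exists n, lower_central_of A n `<=` [set 1].
Proof.
have [n nE] := nilG; exists n; rewrite -nE -lower_central_ofT.
exact: lower_central_of_mono.
Qed.

(** Any element outside [C] of the last term of the lower central series of [A] not contained in [C]
    will do. The set [C] need not be a subgroup: it is used both for a subgroup and for the set of
    elements acting as scalars. *)
Lemma nilpotent_last_central A C : subgroup A -> C 1 -> ~ A `<=` C ->
  exists a, [/\ A a, ~ C a & forall h, A h -> C [~ a, h]].
Proof.
move=> sA C1 nAC; have [n nE] := nilpotent_lower_central_of A.
have [i [nLC LC]] : exists i, ~ lower_central_of A i `<=` C /\
    lower_central_of A i.+1 `<=` C.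
  apply: contrapT => no.
  suff : forall i, ~ lower_central_of A i `<=` C.
    by apply; apply: subset_trans nE _ => _ ->.
  by elim=> [|i IH] // LC; apply: no; exists i.
apply: contrapT => no; apply: nLC => a La; apply: contrapT => nCa; apply: no.
exists a; split=> //; first by apply: lower_central_of_sub La.
by move=> h Ah; apply: LC; exact: lower_central_of_comm.
Qed.

(** An element [a] outside [H] whose commutators with [A] all lie in [H] normalizes [H], because
    [h ^ a] is [h * [~ h, a]]. *)
Lemma nilpotent_normalizer A H : subgroup A -> subgroup H -> H `<=` A ->
  ~ A `<=` H -> exists y, [/\ A y, ~ H y & normalizer H y].
Proof.
move=> sA sH HA /(nilpotent_last_central sA (subgroup1 sH))[a [Aa nHa aH]].
exists a; split=> // h; split=> [Hha|Hh].
  have Ah : A h by apply: (sub_normalizer sA Aa h).1; exact: HA.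
  move: Hha; rewrite conjg_commg; apply: subgroupMr => //.
  by rewrite -invgR; apply: subgroupV => //; exact: aH.
rewrite conjg_commg; apply: subgroupM => //.
by rewrite -invgR; apply: subgroupV => //; apply: aH; exact: HA.
Qed.

Lemma noetherian_sub P Q : Q `<=` P -> noetherian P -> noetherian Q.
Proof. by move=> QP nP A sA AQ; apply: nP => //; exact: subset_trans QP. Qed.

(** Each term of the lower central series is generated by the next term and finitely many
    commutators. Starting from the trivial term, these are adjoined one at a time with
    [noetherian_adjoin]. *)
Lemma nilpotent_noetherian : finitely_generated G -> noetherian [set: G].
Proof.
move=> [s Gs]; have sT := subgroupT.
have fg i : exists2 l : seq G, [set` l] `<=` lower_central_of setT i &
    lower_central_of setT i `<=`
      generated ([set` l] `|` lower_central_of setT i.+1).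
  elim: i => [|i [l lL Ll]].
    by exists s => //; rewrite -Gs; apply: generated_mono; exact: subsetUl.
  exists [seq [~ t, a] | t <- l, a <- s].
    move=> _ /allpairsP[[t a] [/= tl _ ->]].
    by apply: lower_central_of_comm => //; exact: lL.
  apply: (subset_trans (lower_central_of_generated sT (esym Gs) lL Ll)).
  apply: generated_mono => x [[t tl [a al <-]]|Lx]; last by right.
  by left; apply/allpairsP; exists (t, a).
have step i : noetherian (lower_central_of setT i.+1) ->
    noetherian (lower_central_of setT i).
  move=> noe; have [l lL Ll] := fg i; apply: noetherian_sub Ll _.
  set C := lower_central_of setT i.+1 in noe *.
  have sC : subgroup C by exact: subgroup_lower_central_of.
  elim: l lL => [_|a l IH lL].
    by apply: noetherian_sub noe; apply: generated_min => // x [].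
  have lL' : [set` l] `<=` lower_central_of setT i.
    by move=> x xl; apply: lL => /=; rewrite inE; apply/orP; right.
  set P := generated ([set` l] `|` C) in IH *.
  have sP : subgroup P by exact: subgroup_generated.
  have La : lower_central_of setT i a by apply: lL; rewrite /= inE eqxx.
  (* Commutators with [a] fall into the next term [C], hence into [P]. *)
  have Na : normalizer P a.
    have CP z : P [~ z, a].
      rewrite -invgR; apply/(subgroupV sP)/generated_in; right.
      exact: lower_central_of_comm.
    move=> z; rewrite conjg_commg; split=> [|Pz]; first exact: subgroupMr.
    exact: subgroupM.
  apply: noetherian_sub (noetherian_adjoin sP Na (IH lL')).
  apply: generated_min; first exact: subgroup_generated.
  have PQ : P `<=` generated (P `|` [set a]).
    by move=> x Px; apply: generated_in; left.
  move=> x [/=|Cx]; last by apply/PQ/generated_in; right.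
  rewrite inE => /orP[/eqP->|xl]; first by apply: generated_in; right.
  by apply/PQ/generated_in; left.
have [n nE] := nilpotent_lower_central_of setT.
have : noetherian (lower_central_of setT n).
  apply: (noetherian_sub nE) => B sB B1; exists [::]; apply/seteqP; split.
    by move=> x /B1 ->; exact: generated_1.
  by apply: generated_min.
by elim: n {nE} => [|n IH] // /step.
Qed.

(** * Powers lying in a subgroup of a nilpotent group *)

Section PowerOverSubgroup.
Variables (A H S : set G).
Hypotheses (sA : subgroup A) (sH : subgroup H) (HA : H `<=` A).
Hypothesis AS : A = generated S.
Hypothesis powS : forall s, S s -> exists2 n, (0 < n)%N & H (s ^+ n).
Local Notation L := (lower_central_of A).

Let sL n : subgroup (L n). Proof. exact: subgroup_lower_central_of. Qed.
Let AL n : A `<=` normalizer (L n). Proof. exact: lower_central_of_normal. Qed.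
Let SA : S `<=` A. Proof. by rewrite AS; exact: subset_generated. Qed.

Definition power_mod C z :=
  exists k b, [/\ (0 < k)%N, H b & congr_mod C (z ^+ k) b].

(** These left-normed commutators of generators generate [L n] modulo [L n.+1]. *)
Fixpoint iterated_commutators n : set G :=
  if n is m.+1 then
    [set [~ t, s] | t in iterated_commutators m & s in S]
  else S.
Local Notation T := iterated_commutators.

Lemma iterated_commutators_sub n : T n `<=` L n.
Proof.
elim: n => [|n IH] //= _ [t /IH Lt [s /SA As <-]].
exact: lower_central_of_comm.
Qed.

Lemma lower_central_of_iterated n : L n `<=` generated (T n `|` L n.+1).
Proof.
elim: n => [|n IH] /=; last first.
  exact: (lower_central_of_generated sA AS (@iterated_commutators_sub n) IH).
by rewrite {1}AS; apply: generated_mono; exact: subsetUl.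
Qed.

(** By bilinearity, if [u ^+ k] is congruent to [b] in [H] and [s ^+ m] lies in [H], then [[~ u, s]
    ^+ (k * m)] is congruent to [[~ b, s ^+ m]], a commutator of elements of [H]. *)
Lemma power_mod_iterated n t : T n t -> power_mod (L n.+1) t.
Proof.
elim: n t => [|n IH] t.
  move=> /powS[k k0 Hk]; exists k, (t ^+ k); split=> //.
  exact: congr_mod_refl.
move=> [u Tu [s Ss <-]]; have [k [b [k0 Hb ub]]] := IH u Tu.
have [m m0 Hm] := powS Ss; have As := SA Ss.
have Lu : L n u by exact: iterated_commutators_sub Tu.
have Au : A u by exact: lower_central_of_sub Lu.
have Ab := HA Hb.
have Lb : L n b.
  have : L n (u ^+ k * (u ^- k * b)).
    apply: subgroupM => //; first exact: subgroupX.
    exact: lower_central_of_decr.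
  by rewrite mulVKg.
exists (k * m)%N, [~ b, s ^+ m]; split; first by rewrite muln_gt0 k0.
  exact: subgroupR.
have cen x y a : L n x -> A y -> A a -> L n.+2 [~ [~ x, y], a].
  by move=> Lx Ay Aa; apply: lower_central_of_comm => //; exact: lower_central_of_comm.
apply: (congr_mod_trans (sL _) (y := [~ b, s] ^+ m)); last first.
  apply: congr_mod_sym => //; apply: (congr_mod_commgX sA) => // a; exact: cen.
rewrite expgnA; apply: (congr_modX sA (sL _) (@AL _) m) => //.
  by apply: subgroupX => //; exact: subgroupR.
apply: (congr_mod_trans (sL _) (y := [~ u ^+ k, s])).
  apply: congr_mod_sym => //; apply: (congr_mod_commXg sA) => // a; exact: cen.
rewrite -{1}[b](mulVKg (u ^+ k)) commMg.
set c := u ^- k * b in ub *; rewrite /congr_mod.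
have Lc : L n.+2 [~ c, s] by exact: lower_central_of_comm.
rewrite mulgA; apply: subgroupM => //; rewrite -/(congr_mod _ _ _).
apply: congr_mod_sym => //; apply: congr_mod_conj => //; apply: cen => //.
  exact: subgroupX.
exact: (lower_central_of_sub sA ub).
Qed.

(** The quotient of [L n] by [L n.+1] is abelian, so the property passes from the generators of
    [L n] to products and inverses; for a product the two exponents are multiplied. *)
Lemma power_mod_lower_central n z : L n z -> power_mod (L n.+1) z.
Proof.
have H1 : H 1 by exact: subgroup1.
move=> /lower_central_of_iterated gz.
suff [] : L n z /\ power_mod (L n.+1) z by [].
elim: gz => {z} [z [Tz|Lz]||x y _ [Lx [k [b [k0 Hb xb]]]] _ [Ly [l [c [l0 Hc yc]]]]
    |x _ [Lx [k [b [k0 Hb xb]]]]].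
- by split; [exact: iterated_commutators_sub|exact: power_mod_iterated].
- split; first exact: lower_central_of_decr.
  exists 1%N, 1; split=> //; rewrite expg1 /congr_mod mulg1.
  exact: subgroupV.
- split; first exact: subgroup1.
  by exists 1%N, 1; split=> //; exact: congr_mod_refl.
- split; first exact: subgroupM.
  have Ax : A x by exact: lower_central_of_sub Lx.
  have Ay : A y by exact: lower_central_of_sub Ly.
  exists (k * l)%N, (b ^+ l * c ^+ k); split; first by rewrite muln_gt0 k0.
    by apply: subgroupM => //; exact: subgroupX.
  apply: (congr_mod_trans (sL _) (y := x ^+ (k * l) * y ^+ (k * l))).
    by apply: (congr_modXM sA) => //; exact: lower_central_of_comm.
  apply: (congr_modM (A := A)) => //; first exact: subgroupX.
    by rewrite expgnA; apply: (congr_modX sA (sL _) (@AL _) l) => //; exact: subgroupX.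
  rewrite mulnC expgnA; apply: (congr_modX sA (sL _) (@AL _) k) => //.
  exact: subgroupX.
- split; first exact: subgroupV.
  have Ax : A x by exact: lower_central_of_sub Lx.
  exists k, b^-1; split=> //; first exact: subgroupV.
  rewrite expVgn /congr_mod invgK.
  have -> : x ^+ k * b^-1 = ((x ^- k * b)^-1) ^ (x ^- k) by rewrite conjgE; gsimp.
  apply/AL; last exact: subgroupV.
  by apply: subgroupV => //; exact: subgroupX.
Qed.

(** Descend the series. If [z ^+ k] agrees with [b] in [H] up to an error [x] in [L n], a power of
    [x] agrees with some [c] in [H] modulo [L n.+1]; raising to that power moves the error into
    [L n.+1]. Finally the error is trivial. *)
Lemma power_in_subgroup z : A z -> exists2 k, (0 < k)%N & H (z ^+ k).
Proof.
move=> Az; have H1 : H 1 by exact: subgroup1.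
have pw n : power_mod (L n) z.
  elim: n => [|n [k [b [k0 Hb zb]]]].
    exists 1%N, 1; split=> //; rewrite /congr_mod /= mulg1 expg1.
    exact: subgroupV.
  have [l [c [l0 Hc xc]]] := power_mod_lower_central zb.
  set x := z ^- k * b in xc zb.
  have Ab := HA Hb; have Ax : A x by exact: lower_central_of_sub zb.
  exists (k * l)%N, (b ^+ l * c^-1); split; first by rewrite muln_gt0 k0.
    by apply: subgroupM => //; [exact: subgroupX|exact: subgroupV].
  have zE : z ^+ k = b * x^-1 by rewrite /x; gsimp.
  have Lx : L n x^-1 by exact: subgroupV.
  rewrite expgnA zE.
  apply: (congr_mod_trans (sL _) (y := b ^+ l * x^-1 ^+ l)).
    apply: (congr_modXM sA) => //; first exact: subgroupV.
    rewrite -invgR; apply: subgroupV => //.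
    exact: lower_central_of_comm.
  have AV : A (x^-1 ^+ l) by apply: subgroupX => //; exact: subgroupV.
  apply: (congr_modM (A := A)) => //; first exact: congr_mod_refl.
  rewrite expVgn /congr_mod invgK.
  have -> : x ^+ l * c^-1 = ((x ^- l * c)^-1) ^ (x ^- l) by rewrite conjgE; gsimp.
  apply/AL; last exact: subgroupV.
  by rewrite -expVgn.
have [n nE] := nilpotent_lower_central_of A.
have [k [b [k0 Hb /nE/mulg1_eq]]] := pw n.
by rewrite invgK => zb; exists k => //; rewrite zb.
Qed.

End PowerOverSubgroup.

(* If x were outside H, then H would be proper in <H, x>, hence in its normalizer
   there, while every element of <H, x> has a power in H. *)
Lemma isolated_of_normalizer H : subgroup H ->
  (forall y m, normalizer H y -> (0 < m)%N -> H (y ^+ m) -> H y) ->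
  forall x m, (0 < m)%N -> H (x ^+ m) -> H x.
Proof.
move=> sH iso x m m0 Hxm; apply: contrapT => nHx.
pose S := H `|` [set x]; have sA := subgroup_generated S.
have HA : H `<=` generated S by move=> h Hh; apply: generated_in; left.
have powS s : S s -> exists2 n, (0 < n)%N & H (s ^+ n).
  by case=> [Hs|->]; [exists 1%N; rewrite ?expg1|exists m].
have [|y [Ay nHy Ny]] := nilpotent_normalizer sA sH HA.
  by move=> AH; apply: nHx; apply: AH; apply: generated_in; right.
have [k k0 Hyk] := power_in_subgroup sA sH HA erefl powS Ay.
exact: nHy (iso _ _ Ny k0 Hyk).
Qed.

End Nilpotent.

End Subgroups.

Local Open Scope ring_scope.

(** * Internally induced subspaces *)

Section Subspaces.
Variables (K : fieldType) (V : lmodType K).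
Implicit Types (A B U W X Y : set V) (u v w x y : V).

Definition subspace U := U 0 /\ forall k u v, U u -> U v -> U (k *: u + v).

Definition nonzero U := exists2 u, U u & u != 0.

Definition line u : set V := [set v | exists k, v = k *: u].

Lemma subspace0 U : subspace U -> U 0. Proof. by case. Qed.
Lemma subspaceP U k u v : subspace U -> U u -> U v -> U (k *: u + v).
Proof. by case=> _; exact. Qed.
Lemma subspaceD U u v : subspace U -> U u -> U v -> U (u + v).
Proof. by move=> sU Uu Uv; rewrite -[u]scale1r; exact: subspaceP. Qed.
Lemma subspaceZ U k u : subspace U -> U u -> U (k *: u).
Proof.
move=> sU Uu; rewrite -[_ *: _]addr0; apply: subspaceP => //.
exact: subspace0.
Qed.
Lemma subspaceN U u : subspace U -> U u -> U (- u).
Proof. by rewrite -scaleN1r; exact: subspaceZ. Qed.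
Lemma subspaceB U u v : subspace U -> U u -> U v -> U (u - v).
Proof. by move=> sU Uu Uv; apply: subspaceD => //; exact: subspaceN. Qed.
Lemma subspace_sum U n (f : 'I_n -> V) :
  subspace U -> (forall i, U (f i)) -> U (\sum_i f i).
Proof.
move=> sU Uf; elim/big_ind: _ => //; first exact: subspace0.
by move=> x y; exact: subspaceD.
Qed.
Lemma subspaceI U W : subspace U -> subspace W -> subspace (U `&` W).
Proof.
move=> sU sW; split; first by split; exact: subspace0.
by move=> k u v [Uu Wu] [Uv Wv]; split; exact: subspaceP.
Qed.

Inductive linear_span A : set V :=
| span_0 : linear_span A 0
| span_lin k u v of A u & linear_span A v : linear_span A (k *: u + v).

Lemma subset_span A : A `<=` linear_span A.
Proof.
by move=> u Au; rewrite -[u]addr0 -[u]scale1r; apply: span_lin => //; exact: span_0.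
Qed.

Lemma span_min A U : subspace U -> A `<=` U -> linear_span A `<=` U.
Proof.
move=> sU AU u; elim=> {u} [|k u v /AU Uu _ Uv]; first exact: subspace0.
exact: subspaceP.
Qed.

Lemma subspace_span A : subspace (linear_span A).
Proof.
split; first exact: span_0.
move=> k u v; elim=> {u} [|l u w Au _ IH] Av; first by rewrite scaler0 add0r.
by rewrite scalerDr scalerA -addrA; apply: span_lin => //; exact: IH.
Qed.

Lemma span_mono A B : A `<=` B -> linear_span A `<=` linear_span B.
Proof.
by move=> AB; apply: span_min; [exact: subspace_span|move=> x /AB; exact: subset_span].
Qed.

(** * Linear independence and finite dimension *)

Definition free_family n (e : 'I_n -> V) :=
  forall c : 'I_n -> K, \sum_i c i *: e i = 0 -> forall i, c i = 0.

(** Dimension enters only through this predicate: its failure says that the dimension is below [n],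
    and such an [n] is the measure for inductions. *)
Definition has_free n U :=
  exists2 e : 'I_n -> V, (forall i, U (e i)) & free_family e.

Definition finite_span U := exists s : seq V, U `<=` linear_span [set` s].

Lemma has_free0 U : has_free 0 U.
Proof. by exists (fun=> 0) => [[]|c _ []]. Qed.

Lemma has_free_proper n U W x : subspace U -> U `<=` W -> W x -> ~ U x ->
  has_free n U -> has_free n.+1 W.
Proof.
move=> sU UW Wx nUx [e Ue fe].
exists (fun i => if unlift ord0 i is Some j then e j else x).
  by move=> i; case: unliftP => [j _|_] //; exact: UW.
move=> c; rewrite big_ord_recl unlift_none.
under eq_bigr => i _ do rewrite liftK.
move=> c0; have c00 : c ord0 = 0.
  apply: contrapT => /eqP cn; apply: nUx.
  have -> : x = - (c ord0)^-1 *: \sum_(i < n) c (lift ord0 i) *: e i.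
    move/eqP: c0; rewrite addr_eq0 => /eqP c0.
    by rewrite scaleNr -scalerN -c0 scalerA mulVf ?scale1r.
  apply: subspaceZ => //; apply: subspace_sum => // i; exact: subspaceZ.
move: c0; rewrite c00 scale0r add0r => /fe cj i.
by case: (unliftP ord0 i) => [j ->|->].
Qed.

Lemma span_seq (s : seq V) v : linear_span [set` s] v ->
  exists c : 'I_(size s) -> K, v = \sum_i c i *: s`_i.
Proof.
elim=> {v} [|k u v /= us _ [c ->]].
  by exists (fun=> 0); rewrite big1 // => i _; rewrite scale0r.
move: us; rewrite -index_mem => us; pose j := Ordinal us.
exists (fun i => (i == j)%:R * k + c i).
under [in RHS]eq_bigr => i _ do rewrite scalerDl.
rewrite big_split /=; congr (_ + _).
rewrite (bigD1 j) //= eqxx mul1r nth_index -?index_mem // big1 ?addr0 //.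
by move=> i /negPf ->; rewrite mul0r scale0r.
Qed.

(** More vectors than spanning vectors give a coefficient matrix with more rows than columns, and a
    nonzero row of its left kernel is a linear dependence. *)
Lemma finite_span_free U : finite_span U -> exists n, ~ has_free n U.
Proof.
move=> [s Us]; exists (size s).+1 => -[e Ue fe].
have [A AE] := choice (fun j => span_seq (Us _ (Ue j))).
pose M := \matrix_(j, i) A j i.
have kM : kermx M != 0.
  rewrite kermx_eq0 /row_free; apply: contraTneq (rank_leq_col M) => ->.
  by rewrite ltnn.
have [i ki] : exists i, row i (kermx M) != 0.
  apply: contrapT => no; case/eqP: kM; apply/row_matrixP => i; rewrite row0.
  by apply: contrapT => /eqP ni; apply: no; exists i.
set r := row i (kermx M) in ki.
have rM : r *m M = 0 by rewrite -row_mul mulmx_ker row0.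
case/eqP: ki; apply/rowP => j; rewrite [RHS]mxE.
apply: (fe (fun j => r ord0 j)).
under eq_bigr => k _ do rewrite AE scaler_sumr.
rewrite exchange_big big1 //= => k _.
under eq_bigr => l _ do rewrite scalerA.
rewrite -scaler_suml; have /rowP/(_ k) := rM; rewrite mxE [RHS]mxE => rk.
rewrite (eq_bigr (fun l => r ord0 l * M l k)) ?rk ?scale0r //.
by move=> l _; rewrite [M _ _]mxE.
Qed.

Lemma finite_span_sub U W : U `<=` W -> finite_span W -> finite_span U.
Proof. by move=> UW [s Ws]; exists s; exact: subset_trans Ws. Qed.

End Subspaces.

Section Representation.
Variables (K : fieldType) (G : groupType) (V : lmodType K).
Variable pi : representation (K := K) (G := G) predT V.
Implicit Types (H N : set G) (U W X Y Z M : set V) (g h : G) (u v w x y : V).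

Lemma act_linear k g u v : pi g (k *: u + v) = k *: pi g u + pi g v.
Proof. by case: (reprP pi) => lin _ _; exact: lin. Qed.
Lemma act1 v : pi 1%g v = v. Proof. by case: (reprP pi) => _ + _; exact. Qed.
Lemma actM g h v : pi (g * h)%g v = pi g (pi h v).
Proof. by case: (reprP pi) => _ _ mul; rewrite mul. Qed.
Lemma act0 g : pi g 0 = 0.
Proof. by have := act_linear (-1) g 0 0; rewrite scaler0 addr0 scaleN1r addNr. Qed.
Lemma actZ k g v : pi g (k *: v) = k *: pi g v.
Proof. by have := act_linear k g v 0; rewrite act0 !addr0. Qed.
Lemma actD g u v : pi g (u + v) = pi g u + pi g v.
Proof. by have := act_linear 1 g u v; rewrite !scale1r. Qed.
Lemma actN g v : pi g (- v) = - pi g v.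
Proof. by rewrite -scaleN1r actZ scaleN1r. Qed.
Lemma actB g u v : pi g (u - v) = pi g u - pi g v.
Proof. by rewrite actD actN. Qed.
Lemma actK g v : pi g^-1%g (pi g v) = v.
Proof. by rewrite -actM mulVg act1. Qed.
Lemma actKV g v : pi g (pi g^-1%g v) = v.
Proof. by rewrite -actM mulgV act1. Qed.
Lemma act_eq0 g v : pi g v = 0 -> v = 0.
Proof. by move=> e; rewrite -(actK g v) e act0. Qed.
Lemma act_sum g n (f : 'I_n -> V) : pi g (\sum_i f i) = \sum_i pi g (f i).
Proof.
exact: (big_morph (pi g) (fun x y => actD g x y) (act0 g)).
Qed.

Definition stable H U := forall h u, H h -> U u -> U (pi h u).

(** The image of [U] under [pi g], written as a preimage so that membership involves no
    existential. *)
Definition translate g U : set V := [set v | U (pi g^-1%g v)].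

Definition irreducible H U :=
  [/\ subspace U, stable H U, nonzero U &
      forall Y, subspace Y -> stable H Y -> Y `<=` U -> nonzero Y -> U `<=` Y].

Definition linear_relation H (R : V -> V -> Prop) :=
  [/\ R 0 0, forall k x x' y y', R x y -> R x' y' -> R (k *: x + x') (k *: y + y')
    & forall h x y, H h -> R x y -> R (pi h x) (pi h y)].

(* Equivariant isomorphisms are encoded by their graphs. *)
Definition iso H X Y := exists2 R : V -> V -> Prop, linear_relation H R &
  [/\ forall x y, R x y -> X x /\ Y y,
      (forall x, X x -> exists y, R x y) /\ (forall y, Y y -> exists x, R x y)
    & (forall x, R x 0 -> x = 0) /\ (forall y, R 0 y -> y = 0)].

Lemma linear_relationB H R x x' y y' : linear_relation H R ->
  R x y -> R x' y' -> R (x - x') (y - y').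
Proof.
move=> [_ lin _] Rx Rx'; have := lin (-1) _ _ _ _ Rx' Rx.
by rewrite !scaleN1r ![- _ + _]addrC.
Qed.

Lemma iso_sym H X Y : iso H X Y -> iso H Y X.
Proof.
move=> [R [R0 lin eqv] [sub [tl tr] [z1 z2]]]; exists (fun x y => R y x).
  by split=> // [k x x' y y'|h x y]; [exact: lin|exact: eqv].
by split=> // x y /sub[].
Qed.

Lemma iso_trans H X Y Z : iso H X Y -> iso H Y Z -> iso H X Z.
Proof.
move=> [R [R0 lin eqv] [sub [tl tr] [z1 z2]]] [S [S0 slin seqv] [ssub [stl str] [sz1 sz2]]].
exists (fun x z => exists2 y, R x y & S y z).
  split.
  - by exists 0.
  - move=> k x x' z z' [y Rxy Syz] [y' Rxy' Syz']; exists (k *: y + y').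
      exact: lin.
    exact: slin.
  - by move=> h x z Hh [y Rxy Syz]; exists (pi h y); [exact: eqv|exact: seqv].
split.
- by move=> x z [y /sub[? _] /ssub[_ ?]].
- split=> [x Xx|z Zz].
    have [y Rxy] := tl x Xx; have [z Syz] := stl y (sub _ _ Rxy).2.
    by exists z, y.
  have [y Syz] := str z Zz; have [x Rxy] := tr y (ssub _ _ Syz).1.
  by exists x, y.
- split=> [x [y Rxy /sz1 y0]|z [y Rxy Syz]]; first by apply: z1; rewrite -y0.
  by apply: sz2; rewrite -(z2 _ Rxy).
Qed.

Lemma iso_irreducible H X Y : iso H X Y -> irreducible H Y -> irreducible H X.
Proof.
move=> [R LR [sub [tl tr] [z1 z2]]] [sY stY nzY minY].
have [R0 lin eqv] := LR.
split.
- split; first by have [] := sub _ _ R0.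
  move=> k u v /tl[y Ruy] /tl[y' Rvy'].
  by have [] := sub _ _ (lin k _ _ _ _ Ruy Rvy').
- move=> h u Hh /tl[y Ruy].
  by have [] := sub _ _ (eqv _ _ _ Hh Ruy).
- case: nzY => y /tr[x Rxy] yn; exists x; first by have [] := sub _ _ Rxy.
  apply: contra_neq yn => x0; apply: z2; by rewrite -x0.
move=> Z sZ stZ ZX [z Zz zn] x Xx.
pose I : set V := [set y | exists2 x, Z x & R x y].
have YI : Y `<=` I.
  apply: minY.
  - split; first by exists 0 => //; exact: subspace0.
    move=> k u v [a Za Ra] [b Zb Rb]; exists (k *: a + b); first exact: subspaceP.
    exact: lin.
  - by move=> h u Hh [a Za Ra]; exists (pi h a); [exact: stZ|exact: eqv].
  - by move=> u [a _ /sub[]].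
  - have [y Rzy] := tl z (ZX z Zz); exists y; first by exists z.
    by apply: contra_neq zn => y0; apply: z1; rewrite -y0.
have [y Rxy] := tl x Xx; have [a Za Ray] := YI y (sub _ _ Rxy).2.
have := linear_relationB LR Rxy Ray; rewrite subrr => /z1/eqP.
by rewrite subr_eq0 => /eqP ->.
Qed.

(** Surjectivity is automatic: the image of [R] is a nonzero stable subspace of the irreducible
    [Y]. *)
Lemma iso_of_relation H X Y R : irreducible H Y -> linear_relation H R ->
  (forall x y, R x y -> X x /\ Y y) -> (forall x, X x -> exists y, R x y) ->
  (forall x, R x 0 -> x = 0) -> (forall y, R 0 y -> y = 0) -> nonzero X ->
  iso H X Y.
Proof.
move=> [sY stY nzY minY] LR sub tl z1 z2 [x Xx xn].
have [R0 lin eqv] := LR; exists R => //; split=> //; split=> //.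
apply: minY.
- split; first by exists 0.
  by move=> k u v [a Ra] [b Rb]; exists (k *: a + b); exact: lin.
- by move=> h u Hh [a Ra]; exists (pi h a); exact: eqv.
- by move=> u [a /sub[]].
have [y Rxy] := tl x Xx; exists y; first by exists x.
by apply: contra_neq xn => y0; apply: z1; rewrite -y0.
Qed.

(* Schur's lemma, with the linear map X -> Y given by its graph R. *)
Lemma schur_relation H X Y R : irreducible H X -> irreducible H Y ->
  linear_relation H R -> (forall x y, R x y -> X x /\ Y y) ->
  (forall x, X x -> exists y, R x y) ->
  (forall y, R 0 y -> y = 0) -> (exists x y, R x y /\ y != 0) ->
  iso H X Y.
Proof.
move=> [sX stX nzX minX] iY LR sub tl z2 [x0 [y0 [R00 y0n]]].
have [R0 lin eqv] := LR.
apply: (iso_of_relation iY LR) => // x Rx0; apply: contrapT => /eqP xn.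
have XK : X `<=` [set x | R x 0].
  apply: minX => //.
  - split => //= k u v Ru Rv; have := lin k _ _ _ _ Ru Rv.
    by rewrite scaler0 addr0.
  - by move=> h u Hh /= Ru; have := eqv _ _ _ Hh Ru; rewrite act0.
  - by move=> u /= /sub[].
  - by exists x.
have /XK /= Rx00 := (sub _ _ R00).1.
have := linear_relationB LR R00 Rx00; rewrite subrr subr0 => /z2 y00.
by rewrite y00 eqxx in y0n.
Qed.

Lemma irreducible_eq H X U : irreducible H U -> irreducible H X ->
  X `<=` U -> X = U.
Proof.
move=> [_ _ _ minU] [sX stX nzX _] XU; apply/seteqP; split=> //; exact: minU.
Qed.

Lemma irreducible_exists H E : finite_span E -> subspace E -> stable H E ->
  nonzero E -> exists2 W, irreducible H W & W `<=` E.
Proof.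
move=> /finite_span_free[n]; elim: n E => [|n IH] E nf sE stE nzE.
  by case: nf; exact: has_free0.
have [iE|] := pselect (forall Y, subspace Y -> stable H Y -> Y `<=` E ->
    nonzero Y -> E `<=` Y).
  by exists E.
move=> /existsNP[Y]/not_implyP[sY]/not_implyP[stY]/not_implyP[YE]/not_implyP[nzY nEY].
have [|W iW WY] := IH Y _ sY stY nzY; last by exists W => //; exact: subset_trans YE.
move=> fY; apply: nf; have /existsNP[x /not_implyP[Ex nYx]] := nEY.
exact: has_free_proper sY YE Ex nYx fY.
Qed.

(** * Sums of irreducible subspaces *)

Inductive finite_sum (F : set (set V)) : set (set V) :=
| finite_sum0 : finite_sum F [set 0]
| finite_sumD A W of finite_sum F A & F W :
    finite_sum F [set v | exists2 w, W w & A (v - w)].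

Definition union (F : set (set V)) : set V := [set v | exists2 X, F X & X v].

Lemma span_finite_sum (F : set (set V)) v : (forall X, F X -> subspace X) ->
  linear_span (union F) v -> exists2 A, finite_sum F A & A v.
Proof.
move=> sF; elim=> {v} [|k u v [W FW Wu] _ [A FA Av]].
  by exists [set 0]; [exact: finite_sum0|].
exists [set v | exists2 w, W w & A (v - w)]; first exact: finite_sumD.
by exists (k *: u); [apply: subspaceZ => //; exact: sF|rewrite addrC addKr].
Qed.

Lemma stable_span H A : (forall h u, H h -> A u -> linear_span A (pi h u)) ->
  stable H (linear_span A).
Proof.
move=> st h u Hh; elim=> {u} [|k u v Au _ IH]; first by rewrite act0; exact: span_0.
rewrite act_linear; apply: subspaceP => //; [exact: subspace_span|exact: st].
Qed.

Lemma finite_sum_subspace (F : set (set V)) A : (forall X, F X -> subspace X) ->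
  finite_sum F A -> subspace A.
Proof.
move=> sF; elim=> {A} [|A W _ sA /sF sW].
  by split=> //= k u v -> ->; rewrite scaler0 addr0.
split; first by exists 0; [exact: subspace0|rewrite subrr; exact: subspace0].
move=> k u v [a Wa Au] [b Wb Av]; exists (k *: a + b); first exact: subspaceP.
have -> : k *: u + v - (k *: a + b) = k *: (u - a) + (v - b).
  by rewrite scalerBr opprD addrACA.
exact: subspaceP.
Qed.

Lemma finite_sum_stable H (F : set (set V)) A : (forall X, F X -> stable H X) ->
  finite_sum F A -> stable H A.
Proof.
move=> sF; elim=> {A} [|A W _ sA /sF sW] h u Hh; first by move=> /= ->; rewrite act0.
by move=> [w Ww Aw]; exists (pi h w); [exact: sW|rewrite -actB; exact: sA].
Qed.

(* If Y meets the part A of a sum A + W, induct; otherwise Y is the graph of a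
   map to W, hence isomorphic to W. *)
Lemma irreducible_in_span H (F : set (set V)) Y y :
  (forall X, F X -> irreducible H X) -> subspace Y -> stable H Y ->
  Y y -> y != 0 -> linear_span (union F) y ->
  exists X W, [/\ irreducible H X, X `<=` Y, F W & iso H X W].
Proof.
move=> iF sY stY Yy yn; have sF X : F X -> subspace X by move=> /iF[].
have stF X : F X -> stable H X by move=> /iF[].
move=> /(span_finite_sum sF)[A FA Ay].
elim: FA Y y sY stY Yy yn Ay => {A} [|A W FA IH FW] Y y sY stY Yy yn.
  by move=> /= y0; rewrite y0 eqxx in yn.
move=> AWy; have sA := finite_sum_subspace sF FA.
have stA := finite_sum_stable stF FA.
have [[y' [Yy' Ay' y'n]]|no] := pselect (exists y', [/\ Y y', A y' & y' != 0]).
  exact: IH Yy' y'n Ay'.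
have {no} YA x : Y x -> A x -> x = 0.
  by move=> Yx Ax; apply: contrapT => /eqP xn; apply: no; exists x.
have iW := iF _ FW; have [sW stW _ minW] := iW.
(* If [W] met [A], irreducibility would put [W] inside [A], hence [y] in [A], contrary to [YA]. *)
have AW w : W w -> A w -> w = 0.
  move=> Ww Aw; apply: contrapT => /eqP wn.
  have WA : W `<=` A.
    suff : W `<=` A `&` W by move=> h x /h[].
    apply: minW; first exact: subspaceI.
    - by move=> h u Hh [Au Wu]; split; [exact: stA|exact: stW].
    - by move=> x [].
    - by exists w.
  case: AWy => b /WA Ab Ayb; move/eqP: yn; apply; apply: YA => //.
  by rewrite -(subrK b y); exact: subspaceD.
(* On this part of [Y], [R] is the projection to [W] along [A]: single-valued by [AW], injective by
   [YA]. *)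
pose X := Y `&` [set v | exists2 w, W w & A (v - w)].
pose R x w := [/\ Y x, W w & A (x - w)].
have iXW : iso H X W.
  apply: (@iso_of_relation _ _ _ R) => //.
  - split; first by split; rewrite ?subrr; exact: subspace0.
      move=> k u v a b [Yu Wa Aua] [Yv Wb Avb]; split;
      [exact: subspaceP|exact: subspaceP|].
      have -> : k *: u + v - (k *: a + b) = k *: (u - a) + (v - b).
        by rewrite scalerBr opprD addrACA.
      exact: subspaceP.
    move=> h u a Hh [Yu Wa Aua]; split; [exact: stY|exact: stW|].
    by rewrite -actB; exact: stA.
  - by move=> x w [Yx Ww Axw]; split=> //; split=> //; exists w.
  - by move=> x [Yx [w Ww Axw]]; exists w.
  - by move=> x [Yx _]; rewrite subr0 => Ax; exact: YA.
  - move=> w [_ Ww]; rewrite sub0r => /(subspaceN sA); rewrite opprK; exact: AW.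
  - by exists y.
exists X, W; split=> //; first exact: iso_irreducible iXW iW.
by move=> x [].
Qed.

(** * Translates and internal induction *)

Lemma translateE g U v : translate g U (pi g v) <-> U v.
Proof. by rewrite /translate /= actK. Qed.

Lemma translate1 U : translate 1%g U = U.
Proof. by apply/seteqP; split=> v /=; rewrite /translate /= invg1 act1. Qed.

Lemma translateM g h U : translate (g * h)%g U = translate g (translate h U).
Proof. by apply/seteqP; split=> v; rewrite /translate /= invgM actM. Qed.

Lemma translate_stable H U h : subgroup H -> stable H U -> H h ->
  translate h U = U.
Proof.
move=> sH stU Hh; apply/seteqP; split=> v; rewrite /translate /=.
  by move=> /(stU _ _ Hh); rewrite actKV.
by apply: stU; exact: subgroupV.
Qed.

Lemma subspace_translate g U : subspace U -> subspace (translate g U).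
Proof.
move=> sU; split; rewrite /translate /=; first by rewrite act0; exact: subspace0.
by move=> k u v Uu Uv; rewrite act_linear; exact: subspaceP.
Qed.

Lemma act_conj g h v : pi g^-1%g (pi h v) = pi (h ^ g)%g (pi g^-1%g v).
Proof. by rewrite -!actM conjgE; gsimp. Qed.

Lemma stable_translate H g U : normalizer H g -> stable H U ->
  stable H (translate g U).
Proof.
move=> Ng stU h u Hh Uu; rewrite /translate /= act_conj.
by apply: stU => //; apply/Ng.
Qed.

Lemma irreducible_translate H g U : normalizer H g -> irreducible H U ->
  irreducible H (translate g U).
Proof.
move=> Ng [sU stU [u Uu un] minU]; have NgV := subgroupV (subgroup_normalizer H) Ng.
split; [exact: subspace_translate|exact: stable_translate| |].
  exists (pi g u); first exact/translateE.
  by apply: contra_neq un => /act_eq0.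
move=> Y sY stY YU [y Yy yn] v Uv; rewrite -(actKV g v).
suff : U `<=` translate g^-1%g Y by move=> /(_ _ Uv); rewrite /translate /= invgK.
apply: minU; [exact: subspace_translate|exact: stable_translate| |].
  by move=> w /= /YU; rewrite /translate /= invgK actK.
exists (pi g^-1%g y); first by rewrite /translate /= invgK actKV.
by apply: contra_neq yn => /act_eq0.
Qed.

Lemma iso_translate H g X Y : normalizer H g -> iso H X Y ->
  iso H (translate g X) (translate g Y).
Proof.
move=> Ng [R [R0 lin eqv] [sub [tl tr] [z1 z2]]].
exists (fun x y => R (pi g^-1%g x) (pi g^-1%g y)).
  split; first by rewrite !act0.
    by move=> k x x' y y' Rx Rx'; rewrite !act_linear; exact: lin.
  move=> h x y Hh Rxy; rewrite !act_conj; apply: eqv => //; exact/Ng.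
split; first by move=> x y /sub.
  split=> [x /tl[y Rxy]|y /tr[x Rxy]].
    by exists (pi g y); rewrite actK.
  by exists (pi g x); rewrite actK.
by split=> [x|y]; rewrite act0; [move=> /z1|move=> /z2] => /act_eq0.
Qed.

Lemma iso_refl H X : subspace X -> stable H X -> iso H X X.
Proof.
move=> sX stX; exists (fun x y => X x /\ x = y).
  split; first by split=> //; exact: subspace0.
    by move=> k x x' y y' [Xx <-] [Xx' <-]; split=> //; exact: subspaceP.
  by move=> h x y Hh [Xx <-]; split=> //; exact: stX.
split; first by move=> x y [Xx <-].
  by split=> x Xx; exists x.
by split=> x [].
Qed.

Definition translates (S : set G) U : set V :=
  [set v | exists2 g, S g & translate g U v].

(* M is the direct sum of the translates of W over N / H; the projection p onto
   W along the other translates witnesses that the sum is direct. *)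
Record internally_induced N M H W (p : V -> V) : Prop := InternallyInduced {
  ii_HN : H `<=` N;
  ii_M : subspace M;
  ii_stM : stable N M;
  ii_W : subspace W;
  ii_stW : stable H W;
  ii_WM : W `<=` M;
  ii_linear : forall k u v, M u -> M v -> p (k *: u + v) = k *: p u + p v;
  ii_in : forall u, M u -> W (p u);
  ii_id : forall w, W w -> p w = w;
  ii_equivariant : forall h u, H h -> M u -> p (pi h u) = pi h (p u);
  ii_out : forall g w, N g -> ~ H g -> W w -> p (pi g w) = 0;
  ii_span : M `<=` linear_span (translates N W) }.

Lemma internally_induced_refl H W : subgroup H -> subspace W -> stable H W ->
  internally_induced H W H W id.
Proof.
move=> sH sW stW; split=> // v Wv; apply: subset_span; exists 1%g.
  exact: subgroup1.
by rewrite translate1.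
Qed.

(** Transitivity of induction by composing projections: a translate of [W] by [g] outside [H] is
    killed by [q] if [g] lies in [N], and by [p] otherwise. *)
Lemma internally_induced_trans L M N U H W p q : subgroup L ->
  internally_induced L M N U p -> internally_induced N U H W q ->
  internally_induced L M H W (q \o p).
Proof.
move=> sL P Q; split.
- exact: subset_trans (ii_HN Q) (ii_HN P).
- exact: ii_M P.
- exact: ii_stM P.
- exact: ii_W Q.
- exact: ii_stW Q.
- exact: subset_trans (ii_WM Q) (ii_WM P).
- move=> k u v Mu Mv /=; rewrite (ii_linear P) // (ii_linear Q) //; exact: (ii_in P).
- by move=> u /(ii_in P)/(ii_in Q).
- by move=> w Ww /=; rewrite (ii_id P) ?(ii_id Q) //; apply: (ii_WM Q).
- move=> h u Hh Mu /=; rewrite (ii_equivariant P) ?(ii_equivariant Q) //.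
    exact: (ii_in P).
  exact: (ii_HN Q).
- move=> g w Lg nHg Ww /=; have Uw := ii_WM Q Ww; have [Ng|nNg] := pselect (N g).
    rewrite (ii_equivariant P) //; last exact: (ii_WM P).
    by rewrite (ii_id P) // (ii_out Q).
  rewrite (ii_out P) //; have := ii_linear Q (-1) (ii_W P).1 (ii_W P).1.
  by rewrite scaler0 addr0 scaleN1r addNr.
move=> v /(ii_span P); apply: span_min; first exact: subspace_span.
move=> {}v [g Lg /(ii_span Q) gv].
rewrite -(actKV g v).
elim: gv => [|k u w [h Nh Wu] _ IH]; first by rewrite act0; exact: span_0.
rewrite act_linear; apply: span_lin => //; exists (g * h)%g.
  by apply: subgroupM => //; exact: (ii_HN P).
by rewrite translateM; apply/translateE.
Qed.

Lemma translates_stable N U : subgroup N -> stable N (linear_span (translates N U)).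
Proof.
move=> sN; apply: stable_span => h u Nh [g Ng gu]; apply: subset_span.
by exists (h * g)%g; [exact: subgroupM|rewrite translateM; apply/translateE].
Qed.

Lemma sub_translates N U : subgroup N -> U `<=` linear_span (translates N U).
Proof.
move=> sN u Uu; apply: subset_span; exists 1%g; first exact: subgroup1.
by rewrite translate1.
Qed.

(** * Clifford theory *)

Section Clifford.
Variables (H N : set G) (U : set V).
Hypotheses (sH : subgroup H) (sN : subgroup N) (HN : H `<=` N).
Hypotheses (NH : N `<=` normalizer H) (iU : irreducible H U).
Hypothesis nisoU : forall g, N g -> iso H (translate g U) U -> H g.

Let M := linear_span (translates N U).
Let family : set (set V) := [set X | exists g, [/\ N g, ~ H g & X = translate g U]].
(** The sum of the translates by elements outside [H], which is to be the complement of [U] in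
    [M]. *)
Let C := linear_span (union family).

Let sC : subspace C. Proof. exact: subspace_span. Qed.
Let sM : subspace M. Proof. exact: subspace_span. Qed.
Let sU : subspace U. Proof. by case: iU. Qed.
Let stU : stable H U. Proof. by case: iU. Qed.
Let nzU : nonzero U. Proof. by case: iU. Qed.
Let UM : U `<=` M. Proof. exact: sub_translates. Qed.
Let stM : stable N M. Proof. exact: translates_stable. Qed.

Let ifamily X : family X -> irreducible H X.
Proof. by move=> [g [Ng _ ->]]; apply: irreducible_translate => //; exact: NH. Qed.

Let stC : stable H C.
Proof.
apply: stable_span => h u Hh [X FX Xu]; apply: subset_span; exists X => //.
by case: (ifamily FX) => _ stX _ _; exact: stX.
Qed.

Let family_iso X : family X -> ~ iso H X U.
Proof. by move=> [g [Ng nHg ->]] /(nisoU Ng). Qed.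

(** A nonzero intersection would contain an irreducible subspace isomorphic to a member of [family];
    being irreducible, [U] would equal it. *)
Let UC0 u : U u -> C u -> u = 0.
Proof.
move=> Uu Cu; apply: contrapT => /eqP un.
have [X [W [iX XU FW XW]]] := irreducible_in_span ifamily sU stU Uu un Cu.
by apply: (family_iso FW); rewrite -(irreducible_eq iU iX XU); exact: iso_sym.
Qed.

Let decomposition v : M v -> exists2 u, U u & C (v - u).
Proof.
elim=> {v} [|k v w [g Ng gv] _ [u Uu Cu]].
  by exists 0; [exact: subspace0|rewrite subrr; exact: subspace0].
have [Hg|nHg] := pselect (H g).
  exists (k *: v + u); last by rewrite opprD addrACA subrr add0r.
  by apply: subspaceP => //; rewrite -(translate_stable sH stU Hg).
exists u => //; rewrite -addrA; apply: subspaceP => //.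
by apply: subset_span; exists (translate g U) => //; exists g.
Qed.

Let uniq_decomposition v u u' : U u -> C (v - u) -> U u' -> C (v - u') -> u = u'.
Proof.
move=> Uu Cu Uu' Cu'; apply/eqP; rewrite -subr_eq0; apply/eqP/UC0.
  exact: subspaceB.
have -> : u - u' = (v - u') - (v - u) by rewrite opprB [RHS]addrC addrA addrNK.
exact: subspaceB.
Qed.

(** A nonzero stable [Y] contains a copy of some translate of [U]; translating back gives a copy [Z]
    of [U] inside [Y]. Since [U] occurs in [M] only once, [Z] is [U], and its translates fill
    [M]. *)
Lemma clifford_irreducible : irreducible N M.
Proof.
split => //; first by case: nzU => u /UM Mu un; exists u.
move=> Y sY stY YM [y Yy yn]; suff UY : U `<=` Y.
  apply: span_min => // v [g Ng] gv; rewrite -(actKV g v).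
  by apply: stY => //; exact: UY.
pose F : set (set V) := [set X | exists2 g, N g & X = translate g U].
have iF X : F X -> irreducible H X.
  by move=> [g Ng ->]; apply: irreducible_translate => //; exact: NH.
have yF : linear_span (union F) y.
  apply: span_mono (YM y Yy) => v [g Ng gv]; exists (translate g U) => //.
  by exists g.
have stHY : stable H Y by move=> h u /HN; exact: stY.
have [X [W [iX XY [g Ng WE] XW]]] := irreducible_in_span iF sY stHY Yy yn yF.
have Ngi : N g^-1%g by exact: subgroupV.
pose Z := translate g^-1%g X.
have ZU : iso H Z U.
  have := iso_translate (NH Ngi) XW.
  by rewrite WE -translateM mulVg translate1.
have iZ := iso_irreducible ZU iU.
have ZY : Z `<=` Y.
  move=> z Zz; rewrite -(actK g z); apply: stY => //.
  by move: Zz; rewrite /Z /translate /= invgK => /XY.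
have [sZ stZ _ _] := iZ.
suff ZsU : Z `<=` U by rewrite -(irreducible_eq iU iZ ZsU).
move=> z Zz; have [u Uu Czu] := decomposition (YM _ (ZY _ Zz)).
have [->|zu] := eqVneq z u; first exact: Uu.
(* The graph of the projection of [Z] to [C] along [U]. If [Z] were not inside [U], its image [B]
   would contain a copy [X'] of a member of [family], and Schur's lemma would make [Z], hence [U],
   isomorphic to it. *)
pose R x c := [/\ Z x, C c & U (x - c)].
have LR : linear_relation H R.
  split; first by split; rewrite ?subrr; exact: subspace0.
    move=> k x x' c c' [Zx Cc Uxc] [Zx' Cc' Uxc']; split;
      [exact: subspaceP|exact: subspaceP|].
    have -> : k *: x + x' - (k *: c + c') = k *: (x - c) + (x' - c').
      by rewrite scalerBr opprD addrACA.
    exact: subspaceP.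
  move=> h x c Hh [Zx Cc Uxc]; split; [exact: stZ|exact: stC|].
  by rewrite -actB; exact: stU.
pose B : set V := [set c | exists x, R x c].
have sB : subspace B.
  have [R0 lin _] := LR; split; first by exists 0.
  by move=> k c c' [x Rx] [x' Rx']; exists (k *: x + x'); exact: lin.
have stB : stable H B.
  by have [_ _ eqv] := LR; move=> h c Hh [x Rx]; exists (pi h x); exact: eqv.
have Rz : R z (z - u) by split=> //; rewrite opprB addrC addrNK.
have Bz : B (z - u) by exists z.
have zun : z - u != 0 by rewrite subr_eq0.
have [X' [W' [iX' X'B FW' X'W']]] := irreducible_in_span ifamily sB stB Bz zun Czu.
exfalso; apply: (family_iso FW'); apply: (iso_trans (iso_sym X'W')).
apply: iso_trans ZU; apply: iso_sym.
have [sX' stX' [x' X'x' x'n] _] := iX'.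
pose R' x c := R x c /\ X' c.
pose D : set V := [set x | exists c, R' x c].
have [R0 lin eqv] := LR.
(* The preimage of [X'] in [Z] is nonzero, hence all of [Z], so the restricted relation [R'] is
   defined everywhere. *)
have ZD : Z `<=` D.
  have [_ _ _ minZ] := iZ; apply: minZ.
  - split; first by exists 0; split=> //; exact: subspace0.
    move=> k a b [c [Rc Xc]] [d [Rd Xd]]; exists (k *: c + d).
    by split; [exact: lin|exact: subspaceP].
  - move=> h a Hh [c [Rc Xc]]; exists (pi h c).
    by split; [exact: eqv|exact: stX'].
  - by move=> a [c [[]]].
  - have [x Rx] := X'B _ X'x'; exists x; first by exists x'.
    apply: contra_neq x'n => x0; case: Rx; rewrite x0 sub0r => _ Cx' Ux'.
    by apply: UC0 => //; rewrite -(opprK x'); exact: subspaceN.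
apply: (schur_relation (R := R') iZ iX').
- split; first by split=> //; exact: subspace0.
    by move=> k a b c d [Ra Xa] [Rb Xb]; split; [exact: lin|exact: subspaceP].
  by move=> h a b Hh [Ra Xa]; split; [exact: eqv|exact: stX'].
- by move=> a b [[]].
- by move=> a /ZD.
- move=> b [[_ Cb]]; rewrite sub0r => Ub _; apply: UC0 => //.
  by rewrite -(opprK b); exact: subspaceN.
- by have [x Rx] := X'B _ X'x'; exists x, x'.
Qed.

Lemma clifford_induced : exists p, internally_induced N M H U p.
Proof.
(* The projection to [U] along [C], with arbitrary values outside [M]. *)
have ex v : exists u, M v -> U u /\ C (v - u).
  have [/decomposition[u Uu Cu]|nM] := pselect (M v); first by exists u.
  by exists 0.
have [p pP] := choice ex; exists p.
have pE v u : M v -> U u -> C (v - u) -> p v = u.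
  by move=> /pP[Up Cp] Uu Cu; exact: uniq_decomposition Cu.
split=> //.
- move=> k u v Mu Mv; have [Uu Cu] := pP u Mu; have [Uv Cv] := pP v Mv.
  apply: pE; [exact: subspaceP|exact: subspaceP|].
  have -> : k *: u + v - (k *: p u + p v) = k *: (u - p u) + (v - p v).
    by rewrite scalerBr opprD addrACA.
  exact: subspaceP.
- by move=> u /pP[].
- move=> w Uw; apply: pE => //; first exact: UM.
  by rewrite subrr; exact: subspace0.
- move=> h u Hh Mu; have [Uu Cu] := pP u Mu.
  apply: pE; [by apply: stM => //; exact: HN|exact: stU|].
  by rewrite -actB; exact: stC.
- move=> g w Ng nHg Uw; have gU : translate g U (pi g w) by apply/translateE.
  apply: pE; [by apply: stM => //; exact: UM|exact: subspace0|].
  rewrite subr0; apply: subset_span; exists (translate g U) => //.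
  by exists g.
Qed.

End Clifford.

(** * Detecting vectors and powers with the projection *)

Section Projection.
Variables (N H : set G) (M W : set V) (p : V -> V).
Hypotheses (sN : subgroup N) (sH : subgroup H).
Hypothesis P : internally_induced N M H W p.

Lemma ii_p0 : p 0 = 0.
Proof.
have M0 := subspace0 (ii_M P); have := ii_linear P (-1) M0 M0.
by rewrite scaler0 addr0 scaleN1r addNr.
Qed.

Lemma ii_pZ k u : M u -> p (k *: u) = k *: p u.
Proof.
move=> Mu; have := ii_linear P k Mu (subspace0 (ii_M P)).
by rewrite ii_p0 !addr0.
Qed.

Lemma ii_sum n (f : 'I_n -> V) : (forall i, M (f i)) ->
  p (\sum_i f i) = \sum_i p (f i).
Proof.
elim: n f => [|n IH] f Mf; first by rewrite !big_ord0 ii_p0.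
rewrite !big_ord_recl -[f ord0]scale1r (ii_linear P) ?scale1r ?IH //.
by apply: subspace_sum => //; exact: ii_M P.
Qed.

(** The vectors all of whose translates project to 0 form a stable subspace. If it were nonzero it
    would be [M] and contain [W], where [p] is the identity; then [W] and [M] would vanish. *)
Lemma ii_faithful u : irreducible N M -> M u ->
  (forall n, N n -> p (pi n u) = 0) -> u = 0.
Proof.
move=> [sM stM [m Mm mn] minM] Mu pu; apply: contrapT => /eqP un.
pose Z : set V := [set v | M v /\ forall n, N n -> p (pi n v) = 0].
have MZ : M `<=` Z.
  apply: minM.
  - split; first by split; [exact: subspace0|move=> n _; rewrite act0 ii_p0].
    move=> k v w [Mv pv] [Mw pw]; split; first exact: subspaceP.
    move=> n Nn; rewrite act_linear (ii_linear P) ?pv ?pw ?scaler0 ?addr0 //;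
      exact: stM.
  - move=> h v Nh [Mv pv]; split; first exact: stM.
    by move=> n Nn; rewrite -actM; apply: pv; exact: subgroupM.
  - by move=> v [].
  - by exists u.
have W0 w : W w -> w = 0.
  move=> Ww; have [_ /(_ 1%g (subgroup1 sN))] := MZ _ (ii_WM P Ww).
  by rewrite act1 (ii_id P).
move/eqP: mn; apply; have := ii_span P Mm.
suff h : translates N W `<=` [set 0].
  have := span_min (U := [set 0]) _ h; apply.
  by split=> // k v w -> ->; rewrite scaler0 addr0.
by move=> v [g _ /W0/act_eq0].
Qed.

(** A leading-term argument. If no positive power of [y] lies in [H], then [p (pi (y ^+ k) u)]
    vanishes for large [k]. Take the last [k] where it does not and the first [i] with a nonzero
    coefficient: shifting the relation by the power [k - i] of [y] and projecting leaves a single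
    nonzero term. *)
Lemma ii_power (y : G) u n (c : 'I_n -> K) : N y -> M u -> p u != 0 ->
  (exists i, c i != 0) -> \sum_i c i *: pi (y ^+ i)%g u = 0 ->
  exists2 k, (0 < k)%N & H (y ^+ k)%g.
Proof.
move=> Ny Mu pun [i0 ci0] cu; apply: contrapT => no.
have NX k : N (y ^+ k)%g by exact: subgroupX.
have MX k : M (pi (y ^+ k)%g u) by apply: (ii_stM P).
have bounded v : linear_span (translates N W) v ->
    M v /\ exists b, forall k, (b <= k)%N -> p (pi (y ^+ k)%g v) = 0.
  elim=> {v} [|a v w [g Ng gv] _ [Mw [b bw]]].
    split; first exact: subspace0 (ii_M P).
    by exists 0%N => k _; rewrite act0 ii_p0.
  have vE := actKV g v; set t := pi g^-1%g v in vE.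
  have Wt : W t by [].
  have Mv : M v by rewrite -vE; apply: (ii_stM P) => //; exact: (ii_WM P).
  split; first by apply: subspaceP => //; exact: ii_M P.
  (* If two powers of [y] carried [g] into [H], their quotient would be a positive power of [y] in
     [H]; so at most one does. *)
  have [b' bv] : exists b', forall k, (b' <= k)%N -> p (pi (y ^+ k)%g v) = 0.
    have [[k0 Hk0]|nk] := pselect (exists k, H (y ^+ k * g)%g).
      exists k0.+1 => k kk; rewrite -vE -actM (ii_out P) //.
        by apply: subgroupM.
      move=> Hk; apply: no; exists (k - k0)%N; first by rewrite subn_gt0.
      rewrite expgnFr; last exact: ltnW.
      have := subgroupM sH Hk (subgroupV sH Hk0).
      by rewrite invgM mulgA mulgK.
    exists 0%N => k _; rewrite -vE -actM (ii_out P) //; first exact: subgroupM.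
    by move=> Hk; apply: nk; exists k.
  exists (maxn b b') => k; rewrite geq_max => /andP[bk b'k].
  by rewrite act_linear (ii_linear P) ?bw ?bv ?scaler0 ?addr0 //; apply: (ii_stM P).
have [_ [b bu]] := bounded u (ii_span P Mu).
have exk : exists k, p (pi (y ^+ k)%g u) != 0 by exists 0%N; rewrite expg0 act1.
have ub k : p (pi (y ^+ k)%g u) != 0 -> (k <= b)%N.
  by apply: contraNleq => /ltnW/bu ->.
case: (ex_maxnP exk ub) => k pk kmax.
case: (@arg_minnP _ i0 (fun i => c i != 0) (@nat_of_ord n) ci0) => i ci imin.
(* The shift is [y ^+ k * y ^- i] because [k] may be smaller than [i]. *)
have E0 : \sum_j c j *: pi (y ^+ k * y ^- i * y ^+ j)%g u = 0.
  transitivity (pi (y ^+ k * y ^- i)%g (\sum_i c i *: pi (y ^+ i)%g u)).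
    by rewrite act_sum; apply: eq_bigr => j _; rewrite actZ -actM.
  by rewrite cu act0.
have : p (\sum_j c j *: pi (y ^+ k * y ^- i * y ^+ j)%g u) = 0.
  by rewrite E0 ii_p0.
rewrite ii_sum; last first.
  move=> j; apply: subspaceZ; first exact: ii_M P.
  apply: (ii_stM P) => //; do ?apply: subgroupM => //; exact: subgroupV.
rewrite (bigD1 i) //= big1 => [|j ji].
  rewrite mulgVK ii_pZ // addr0 => /eqP; rewrite scaler_eq0 (negPf ci) /=.
  by rewrite (negPf pk).
have [ij|ji'] := ltnP i j; last first.
  have -> : c j = 0.
    apply: contrapT => /eqP /imin ij; move: ji; rewrite -val_eqE /= eqn_leq.
    by rewrite ji' ij.
  by rewrite scale0r ii_p0.
have -> : (y ^+ k * y ^- i * y ^+ j = y ^+ (k + (j - i)))%g.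
  rewrite expgnDr -mulgA; congr (_ * _)%g.
  rewrite expgnFr; last exact: ltnW.
  by apply/commute_sym/commuteV/commuteX2.
rewrite ii_pZ //; suff -> : p (pi (y ^+ (k + (j - i)))%g u) = 0 by rewrite scaler0.
apply: contrapT => /eqP /kmax.
by rewrite -[X in (_ <= X)%N]addn0 leq_add2l leqn0 subn_eq0 leqNgt ij.
Qed.

End Projection.

(** * Extension of finite weight pairs *)

Definition finite_weight_pair H W :=
  [/\ subgroup H, irreducible H W &
    exists2 E, finite_span E & forall X, iso H X W -> X `<=` E].

Lemma finite_weight_span H W : finite_weight_pair H W -> finite_span W.
Proof.
move=> [sH [sW stW _ _] [E fE EW]]; apply: finite_span_sub fE.
by apply: EW; exact: iso_refl.
Qed.

Lemma translate_conj H g h W : subgroup H -> normalizer H g -> stable H W ->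
  H h -> translate (h * g)%g W = translate g W.
Proof.
move=> sH Ng stW Hh; rewrite conjgC translateM (translate_stable sH stW) //.
exact/Ng.
Qed.

Section Extension.
Variables (H : set G) (W : set V) (y : G) (m : nat).
Hypotheses (gHW : finite_weight_pair H W) (Ny : normalizer H y).
Hypotheses (m_gt0 : (0 < m)%N) (yW : iso H (translate (y ^+ m)%g W) W).

Let H' := generated (H `|` [set y]).
Let sH : subgroup H. Proof. by case: gHW. Qed.
Let sH' : subgroup H'. Proof. exact: subgroup_generated. Qed.
Let HH' : H `<=` H'. Proof. by move=> h Hh; apply: generated_in; left. Qed.
Let iW : irreducible H W. Proof. by case: gHW. Qed.
Let sN := subgroup_normalizer H.

Let NH' : H' `<=` normalizer H.
Proof. by apply: generated_min => // x [|->] //; exact: sub_normalizer. Qed.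

(** Elements of [H] fix the isomorphism class of a translate of [W], while [y] permutes the classes
    cyclically with [y ^+ m] acting trivially on that of [W]. *)
Let finite_orbit g : H' g ->
  exists2 i, (i < m)%N & iso H (translate g W) (translate (y ^+ i)%g W).
Proof.
move: g; have [sW stW _ _] := iW.
pose P g := exists2 i, (i < m)%N & iso H (translate g W) (translate (y ^+ i)%g W).
(* The equivalence inside [D] makes it a subgroup, so that only [H] and [y] need checking. *)
pose D := [set x | normalizer H x /\
  forall g, normalizer H g -> (P g <-> P (x * g)%g)].
have NyV : normalizer H y^-1%g by exact: (subgroupV sN).
suff HD : H' `<=` D.
  move=> g /HD[_ /(_ 1%g (subgroup1 sN))[+ _]]; rewrite mulg1; apply.
  by exists 0%N => //; rewrite translate1; exact: iso_refl.
apply: generated_min.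
  split.
  - by split=> [|g _]; [exact: subgroup1|rewrite mul1g].
  - move=> x x' [Nx Px] [Nx' Px']; split; first exact: (subgroupM sN).
    move=> g Ng; rewrite -mulgA -Px; last exact: (subgroupM sN).
    exact: Px'.
  - move=> x [Nx Px]; split; first exact: (subgroupV sN).
    move=> g Ng; rewrite (Px (x^-1 * g)%g) ?mulVKg //.
    by apply: (subgroupM sN) => //; exact: (subgroupV sN).
move=> x [Hx|->]; split=> //; first exact: sub_normalizer.
  by move=> g Ng; rewrite /P (translate_conj sH Ng stW Hx).
move=> g Ng; split=> -[i im gi].
  have := iso_translate Ny gi; rewrite -!translateM -expgS => gi'.
  have [im'|mi] := ltnP i.+1 m; first by exists i.+1.
  exists 0%N => //; rewrite expg0 translate1; apply: iso_trans gi' _.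
  by have -> : i.+1 = m by apply/eqP; rewrite eqn_leq im mi.
have := iso_translate NyV gi; rewrite -!translateM mulKg.
case: i im {gi} => [|i] im; last first.
  by rewrite expgS mulKg => gi; exists i => //; exact: ltnW.
(* Wrapping around from exponent 0: [y^-1] sends [W] to the class of exponent [m.-1], by [yW]. *)
rewrite expg0 mulg1 => gi; exists m.-1; first by rewrite prednK.
apply: (iso_trans gi); apply: iso_sym; have := iso_translate NyV yW.
by rewrite -!translateM -{1}(prednK m_gt0) expgS mulKg.
Qed.

Let family : set (set V) := [set X | exists2 g, H' g & iso H X (translate g W)].
Let F := linear_span (union family).

Let ifamily X : family X -> irreducible H X.
Proof.
move=> [g H'g XW]; apply: (iso_irreducible XW).
by apply: irreducible_translate => //; exact: NH'.
Qed.

Let family_translate g X : H' g -> family X -> family (translate g X).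
Proof.
move=> H'g [h H'h Xh]; exists (g * h)%g; first exact: subgroupM.
by rewrite translateM; apply: iso_translate => //; exact: NH'.
Qed.

Let stF : stable H' F.
Proof.
apply: stable_span => h u Hh [X FX Xu]; apply: subset_span.
by exists (translate h X); [exact: family_translate|exact/translateE].
Qed.

(** Every member of [family] is isomorphic to the translate of [W] by [y ^+ i] for some [i] below
    [m]; moved back by [y ^- i] it becomes a copy of [W] and lies in [E]. Thus [F] lies in a sum of
    [m] translates of [E]. *)
Let fF : finite_span F.
Proof.
have [_ _ [E [s Es] EW]] := gHW.
pose t := [seq pi (y ^+ i)%g v | i <- iota 0 m, v <- s].
exists t; apply: span_min; first exact: subspace_span.
move=> x [X [g H'g Xg] Xx]; have [i im gi] := finite_orbit H'g.
have NX : normalizer H (y ^+ i)%g by exact: (subgroupX i sN).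
have NXV : normalizer H (y ^- i)%g by exact: (subgroupV sN).
have : iso H (translate (y ^- i)%g X) W.
  have := iso_translate NXV (iso_trans Xg gi).
  by rewrite -translateM mulVg translate1.
move=> /EW/(_ (pi (y ^- i)%g x)); rewrite translateE => /(_ Xx)/Es xs.
rewrite -(actKV (y ^+ i)%g x); elim: xs => [|k u v us _ IH].
  by rewrite act0; exact: span_0.
rewrite act_linear; apply: span_lin => //=; apply/allpairsP; exists (i, u) => /=.
by split=> //; rewrite mem_iota add0n.
Qed.

(** Any irreducible [W'] inside the finite-dimensional [F] works, with [F] as the bounding subspace:
    a copy [X'] of [W'] contains an [H]-subspace from [family], so it meets [F] and therefore lies
    in [F]. *)
Lemma finite_weight_extension :
  exists2 W', finite_weight_pair H' W' & y \in H'.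
Proof.
have sF : subspace F by exact: subspace_span.
have nzF : nonzero F.
  have [sW stW [w Ww wn] _] := iW; exists w => //; apply: subset_span.
  exists W => //; exists 1%g; first exact: subgroup1.
  by rewrite translate1; exact: iso_refl.
have [W' iW' W'F] := irreducible_exists fF sF stF nzF.
exists W'; last by rewrite inE; apply: generated_in; right.
split=> //; exists F => // X' X'W'.
have [sW' stW' [w' W'w' w'n] _] := iW'.
have stHW' : stable H W' by move=> h u /HH'; exact: stW'.
have [X [Z [iX XW' [g H'g Zg] XZ]]] :=
  irreducible_in_span ifamily sW' stHW' W'w' w'n (W'F _ W'w').
have iX' := iso_irreducible X'W' iW'; have [sX' stX' _ minX'] := iX'.
have [R LR [sub [tl tr] [z1 z2]]] := X'W'; have [R0 lin eqv] := LR.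
have [sX stX [x Xx xn] _] := iX.
(* The preimage in [X'] of the irreducible piece [X] of [W']. *)
pose Q : set V := [set a | exists2 b, X b & R a b].
have [q Rqx] := tr x (XW' _ Xx).
have Qq : Q q by exists x.
have qn : q != 0 by apply: contra_neq xn => q0; apply: z2; rewrite -q0.
have QX : iso H Q X.
  apply: (@iso_of_relation _ _ _ (fun a b => X b /\ R a b)) => //.
  - split; first by split=> //; exact: subspace0.
      by move=> k a a' b b' [Xb Rb] [Xb' Rb']; split; [exact: subspaceP|exact: lin].
    by move=> h a b Hh [Xb Rb]; split; [exact: stX|apply: eqv => //; exact: HH'].
  - by move=> a b [Xb Rb]; split=> //; exists b.
  - by move=> a [b Xb Rb]; exists b.
  - by move=> a [_ /z1].
  - by move=> b [_ /z2].
  - by exists q.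
have QF : F q.
  apply: subset_span; exists Q => //; exists g => //.
  exact: iso_trans QX (iso_trans XZ Zg).
suff : X' `<=` X' `&` F by move=> h a /h[].
apply: minX'.
- exact: subspaceI.
- by move=> h u Hh [Xu Fu]; split; [exact: stX'|exact: stF].
- by move=> a [].
- by exists q => //; split=> //; case: Qq => b _ /sub[].
Qed.

End Extension.

(** The preimages of [H] under conjugation by powers of [x] increase, so a maximal one equals its
    successor; conjugating back gives the missing inclusion. *)
Lemma noetherian_conj_normalizer H (x : G) : noetherian [set: G] -> subgroup H ->
  (forall h, H h -> H (h ^ x)%g) -> normalizer H x.
Proof.
move=> noe sH Hx; pose C k := [set z | H (z ^ (x ^+ k))%g].
have [||_ [k _ <-] max] := @noetherian_max _ [set C k | k in setT] noe.
- by move=> _ [k _ <-]; exact: subgroup_conj.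
- by exists (C 0%N); exists 0%N.
move=> t; split=> [Ht|]; last exact: Hx.
have CC : C k.+1 `<=` C k.
  apply: max; first by exists k.+1.
  by move=> z; rewrite /C /= expgSr conjgM; exact: Hx.
have := CC (t ^ (x ^- k))%g; rewrite /C /= expgS -!conjgM => /(_ _).
by rewrite mulVg conjg1 -expgS expgSr mulKg; apply.
Qed.
Lemma linear_relation_sum H R n (a b : 'I_n -> V) (c : 'I_n -> K) :
  linear_relation H R -> (forall i, R (a i) (b i)) ->
  R (\sum_i c i *: a i) (\sum_i c i *: b i).
Proof.
move=> [R0 lin _]; elim: n a b c => [|n IH] a b c Rab; first by rewrite !big_ord0.
by rewrite !big_ord_recl; apply: lin => //; exact: IH.
Qed.

(** * Induction from a maximal finite weight pair *)

Section InducedFromMaximal.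
Hypotheses (nilG : nilpotent_group G) (noeG : noetherian [set: G]).
Variables (H : set G) (W : set V).
Hypothesis fwHW : finite_weight_pair H W.
Hypothesis maxH :
  forall H' W', finite_weight_pair H' W' -> H `<=` H' -> H' `<=` H.

Let sH : subgroup H. Proof. by case: fwHW. Qed.
Let iW : irreducible H W. Proof. by case: fwHW. Qed.

Let self_normalizing (y : G) m :
  normalizer H y -> (0 < m)%N -> iso H (translate (y ^+ m)%g W) W -> H y.
Proof.
move=> Ny m0 yW; have [W' fw'] := finite_weight_extension fwHW Ny m0 yW.
rewrite inE; apply: (maxH fw') => x Hx; by apply: generated_in; left.
Qed.

Let isolated (x : G) m : (0 < m)%N -> H (x ^+ m)%g -> H x.
Proof.
apply: (isolated_of_normalizer nilG sH) => y k Ny k0 Hyk.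
have [sW stW _ _] := iW; apply: (self_normalizing Ny k0).
by rewrite (translate_stable sH) //; exact: iso_refl.
Qed.

Let translate_not_iso N M p g : subgroup N ->
  internally_induced N M H W p -> irreducible N M ->
  normalizer N g -> iso N (translate g M) M -> N g.
Proof.
move=> sN P iM Ng [R LR [sub [tl tr] [z1 z2]]]; have [R0 lin eqv] := LR.
have [sW stW [w Ww wn] _] := iW; have HN := ii_HN P.
have gMw : translate g M (pi g w) by apply/translateE; exact: (ii_WM P).
have [u0 Ru0] := tl _ gMw; have Mu0 := (sub _ _ Ru0).2.
(* The image [u0] of [pi g w] is nonzero, so [ii_faithful] supplies a translate with nonzero
   component in [W]; [g] is then corrected to [x] by that element. *)
have [n [Nn pn]] : exists n, N n /\ p (pi n^-1%g u0) != 0.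
  apply: contrapT => no; case/eqP: wn.
  apply: (act_eq0 (g := g)); apply: z1; suff <- : u0 = 0 by [].
  apply: (ii_faithful sN P iM Mu0) => n Nn; apply: contrapT => /eqP pn; apply: no.
  by exists n^-1%g; rewrite invgK; split=> //; exact: subgroupV.
have Nni : N n^-1%g by exact: subgroupV.
set u := pi n^-1%g u0 in pn; pose x := (n^-1 * g)%g.
have Mu : M u by exact: (ii_stM P).
have Ru : R (pi x w) u by rewrite /x actM; exact: eqv.
have NgV := subgroupV (subgroup_normalizer N) Ng.
have xHN h : H h -> N (h ^ x^-1)%g.
  move=> Hh; rewrite invgM invgK conjgM; apply: subgroupJ => //.
  by apply/NgV; exact: HN.
have xHH h : H h -> H (h ^ x^-1)%g.
  move=> Hh; set y := (h ^ x^-1)%g; have Ny := xHN h Hh : N y.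
  suff [k k0 Hyk] : exists2 k, (0 < k)%N & H (y ^+ k)%g by exact: isolated Hyk.
  (* The vectors [pi (h ^+ i) w] stay in the finite-dimensional [W], so they are dependent. The
     relation [R] carries the dependence to the powers of [y], the conjugate of [h], applied to
     [u]. *)
  have [d nd] := finite_span_free (finite_weight_span fwHW).
  have [c [[i ci] c0]] : exists c : 'I_d -> K, (exists i, c i != 0) /\
      \sum_i c i *: pi (h ^+ i)%g w = 0.
    apply: contrapT => no; apply: nd; exists (fun i => pi (h ^+ i)%g w).
      by move=> i; apply: stW => //; exact: subgroupX.
    move=> c c0 i; apply: contrapT => /eqP ci; apply: no; exists c.
    by split=> //; exists i.
  apply: (ii_power sN sH P Ny Mu pn (c := c)); first by exists i.
  suff : R (pi x (\sum_i c i *: pi (h ^+ i)%g w)) (\sum_i c i *: pi (y ^+ i)%g u).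
    by rewrite c0 act0; exact: z2.
  rewrite act_sum.
  have -> : \sum_i pi x (c i *: pi (h ^+ i)%g w) =
      \sum_i c i *: pi (y ^+ i)%g (pi x w).
    apply: eq_bigr => j _; rewrite actZ -!actM /y -conjXg conjgE.
    by congr (_ *: pi _ _); gsimp.
  apply: (linear_relation_sum (a := fun i => pi (y ^+ i)%g (pi x w))
    (b := fun i => pi (y ^+ i)%g u) c LR) => j.
  by apply: eqv => //; exact: subgroupX.
have Nx : normalizer H x.
  have := noetherian_conj_normalizer noeG sH xHH.
  by move/(subgroupV (subgroup_normalizer H)); rewrite invgK.
suff Hx : H x.
  by rewrite -(mulVKg n g); apply: subgroupM => //; exact: HN.
apply: (self_normalizing (m := 1) Nx) => //; rewrite expg1.
have ixW := irreducible_translate Nx iW.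
have [sxW stxW _ _] := ixW.
(* [R] on the translate of [W] by [x], followed by [p]; it sends [pi x w] to [p u], which is
   nonzero, so Schur's lemma applies. *)
pose R' a b := translate x W a /\ exists v, R a v /\ b = p v.
have sub' a v : R a v -> M v by move=> /sub[].
apply: (schur_relation (R := R') ixW iW).
- split.
  + split; first exact: subspace0.
    by exists 0; rewrite (ii_p0 P).
  + move=> k a a' b b' [Wa [v [Rv ->]]] [Wa' [v' [Rv' ->]]].
    split; first exact: subspaceP.
    exists (k *: v + v'); split; first exact: lin.
    by rewrite (ii_linear P) //; [exact: sub' Rv|exact: sub' Rv'].
  + move=> h a b Hh [Wa [v [Rv ->]]]; split; first exact: stxW.
    exists (pi h v); split; first by apply: eqv => //; exact: HN.
    by rewrite (ii_equivariant P) //; exact: sub' Rv.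
- by move=> a b [Wa [v [/sub' Mv ->]]]; split=> //; exact: (ii_in P).
- move=> a xWa; have gMa : translate g M a.
    rewrite /translate /= -(actKV x a) -actM /x mulgA.
    have -> : (g^-1 * n^-1 * g)%g = (n^-1 ^ g)%g by rewrite conjgE mulgA.
    by apply: (ii_stM P); [apply/Ng|exact: (ii_WM P)].
  by have [v Rv] := tl a gMa; exists (p v); split=> //; exists v.
- by move=> b [_ [v [/z2 -> ->]]]; rewrite (ii_p0 P).
- by exists (pi x w), (p u); split=> //; split; [exact/translateE|exists u].
Qed.

Lemma induced_from_maximal : irreducible setT setT ->
  exists p, internally_induced setT setT H W p.
Proof.
move=> iV; pose good N := [/\ subgroup N, H `<=` N &
  exists M p, internally_induced N M H W p /\ irreducible N M].
have [sW stW _ _] := iW.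
have [||N [sN HN [M [p [P iM]]]] maxN] := @noetherian_max _ good noeG.
- by move=> N [].
- exists H; split=> //; exists W, id; split=> //.
  exact: internally_induced_refl.
have NT : [set: G] `<=` N.
  apply: contrapT => nN.
  have [y [_ nNy Ny]] := nilpotent_normalizer nilG (subgroupT G) sN (fun _ _ => I) nN.
  have sNN := subgroup_normalizer N; have NNN := sub_normalizer sN.
  have noniso g : normalizer N g -> iso N (translate g M) M -> N g.
    exact: translate_not_iso P iM.
  have [q Q] := clifford_induced sN sNN NNN (@subset_refl _ _) iM noniso.
  have iQ := clifford_irreducible sN sNN NNN (@subset_refl _ _) iM noniso.
  apply: nNy; apply: maxN Ny => //; split=> //; first exact: subset_trans NNN.
  exists (linear_span (translates (normalizer N) M)), (p \o q); split=> //.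
  exact: internally_induced_trans Q P.
have NE : N = setT by apply/seteqP; split.
subst N; have [sM stM nzM _] := iM; have [_ _ _ minV] := iV.
have ME : M = setT by apply/seteqP; split=> //; apply: minV.
by subst M; exists p.
Qed.

End InducedFromMaximal.

End Representation.

(** * Finite-dimensional irreducible subspaces *)

Section Monomial.
Variables (K : closedFieldType) (G : groupType) (V : lmodType K).
Variable pi : representation (K := K) (G := G) predT V.
Implicit Types (H N : set G) (U W X Y Z M : set V) (g h a : G) (u v w : V).

(** * Eigenvectors over an algebraically closed field *)

Lemma eigenvector_of_annihilator U a n (q : {poly K}) u : subspace U ->
  (forall v, U v -> U (pi a v)) -> (size q <= n)%N -> q != 0 ->
  U u -> u != 0 -> \sum_(i < n) q`_i *: pi (a ^+ i)%g u = 0 ->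
  exists l v, [/\ U v, v != 0 & pi a v = l *: v].
Proof.
move=> sU aU; elim: n q u => [|n IH] q u.
  by rewrite leqn0 size_poly_eq0 => /eqP ->; rewrite eqxx.
move=> qn q0 Uu un; have [|q1] := boolP (size q == 1).
  move=> /size_poly1P[c c0 ->]; rewrite big_ord_recl coefC /= big1 => [|i _].
    rewrite expg0 act1 addr0 => /eqP; rewrite scaler_eq0 (negPf c0) /=.
    by rewrite (negPf un).
  by rewrite coefC /= scale0r.
(* Split off a root [l]. Either [u] is an eigenvector for [l], or the cofactor [r] annihilates the
   nonzero vector [pi a u - l *: u]. *)
have [l /factor_theorem[r qr]] := closed_rootP _ q1.
have r0 : r != 0 by apply: contra_neq q0 => r0; rewrite qr r0 mul0r.
have rn : (size r <= n)%N.
  move: qn; rewrite qr size_Mmonic ?monicXsubC // size_XsubC addn2 /=.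
  by rewrite ltnS.
have [au|/eqP au] := pselect (pi a u - l *: u = 0).
  move=> _; exists l, u; split=> //; apply/eqP.
  by rewrite -subr_eq0 au.
move=> E; apply: (IH r (pi a u - l *: u)) => //.
  by apply: subspaceB => //; [exact: aU|exact: subspaceZ].
rewrite -[RHS]E; have rN : r`_n = 0 by rewrite nth_default.
under eq_bigr => i _ do rewrite actB actZ scalerBr -actM -expgSr scalerA.
rewrite sumrB.
transitivity (\sum_(i < n.+1) ((r * 'X)`_i *: pi (a ^+ i)%g u
    - (r`_i * l) *: pi (a ^+ i)%g u)); last first.
  by apply: eq_bigr => i _; rewrite -scalerBl qr mulrBr coefB coefMC.
rewrite sumrB; congr (_ - _).
  rewrite big_ord_recl coefMX /= scale0r add0r; apply: eq_bigr => i _.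
  by rewrite coefMX.
by rewrite big_ord_recr /= rN mul0r scale0r addr0.
Qed.

Lemma eigenvector_exists U a : subspace U -> (forall v, U v -> U (pi a v)) ->
  finite_span U -> nonzero U ->
  exists l v, [/\ U v, v != 0 & pi a v = l *: v].
Proof.
move=> sU aU /finite_span_free[n nf] [u Uu un].
have aX i : U (pi (a ^+ i)%g u).
  elim: i => [|i IH]; first by rewrite expg0 act1.
  by rewrite expgS actM; exact: aU.
have [c [[i ci] c0]] : exists c : 'I_n -> K, (exists i, c i != 0) /\
    \sum_i c i *: pi (a ^+ i)%g u = 0.
  apply: contrapT => no; apply: nf; exists (fun i => pi (a ^+ i)%g u) => //.
  move=> c c0 i; apply: contrapT => /eqP ci; apply: no; exists c.
  by split=> //; exists i.
pose q := \poly_(i < n) (if insub i is Some j then c j else 0).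
have qE (j : 'I_n) : q`_j = c j by rewrite coef_poly ltn_ord valK.
apply: (@eigenvector_of_annihilator U a n q u) => //.
- exact: size_poly.
- by apply: contra_neq ci => q0; rewrite -qE q0 coef0.
- by rewrite -[RHS]c0; apply: eq_bigr => j _; rewrite qE.
Qed.

(** * Reduction of a finite-dimensional irreducible subspace to a line *)

Section CliffordStep.
Hypothesis nilG : nilpotent_group G.
Variables (H : set G) (U : set V).
Hypotheses (sH : subgroup H) (iU : irreducible pi H U) (fU : finite_span U).

Lemma scalar_irreducible :
  (forall h, H h -> exists c, forall u, U u -> pi h u = c *: u) ->
  exists2 u, u != 0 & U = line u.
Proof.
move=> sc; have [sU stU [u Uu un] minU] := iU.
exists u => //; apply/seteqP; split; last by move=> _ [k ->]; exact: subspaceZ.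
apply: minU.
- split; first by exists 0; rewrite scale0r.
  by move=> k _ _ [a ->] [b ->]; exists (k * a + b); rewrite scalerDl scalerA.
- move=> h _ Hh [k ->]; have [c cU] := sc h Hh.
  by exists (k * c); rewrite actZ cU // scalerA.
- by move=> _ [k ->]; exact: subspaceZ.
- by exists u => //; exists 1; rewrite scale1r.
Qed.

(** Choose [a] nonscalar on [U] but central modulo scalars. Elements of [H] commute with [a] up to
    scalars and so permute its eigenspaces; [H'] consists of those commuting with [a] on [U]. As [a]
    lies in [H'], an [H']-isomorphism preserves its eigenvalue, which separates the translates of
    [U'] and allows Clifford theory. *)
Lemma nonscalar_induced :
  ~ (forall h, H h -> exists c, forall u, U u -> pi h u = c *: u) ->
  exists H' U' p, [/\ subgroup H', irreducible pi H' U',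
    internally_induced pi H U H' U' p & exists2 x, U x & ~ U' x].
Proof.
move=> nsc; have [sU stU nzU minU] := iU.
pose C : set G := [set h | exists c, forall u, U u -> pi h u = c *: u].
have C1 : C 1%g by exists 1 => u _; rewrite act1 scale1r.
have [a [Ha nCa aC]] := nilpotent_last_central nilG sH C1 nsc.
have aU v : U v -> U (pi a v) by exact: stU.
have [l [v0 [Uv0 v0n av0]]] := eigenvector_exists sU aU fU nzU.
pose E := U `&` [set v | pi a v = l *: v].
have sE : subspace E.
  apply: subspaceI => //; split=> /=; first by rewrite act0 scaler0.
  move=> k u v /= au av.
  by rewrite act_linear au av scalerDr !scalerA mulrC.
have comm h : H h -> exists c, forall u, U u -> pi a (pi h u) = c *: pi h (pi a u).
  move=> Hh; have [c cU] := aC h Hh; exists c => u Uu.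
  by rewrite -actM commgC actM cU // actZ actM.
pose H' : set G := [set h | H h /\ forall u, U u -> pi a (pi h u) = pi h (pi a u)].
have H'H : H' `<=` H by move=> h [].
have sH' : subgroup H'.
  split.
  - by split; [exact: subgroup1|move=> u _; rewrite !act1].
  - move=> h k [Hh ch] [Hk ck]; split; first exact: subgroupM.
    by move=> u Uu; rewrite !actM ch ?ck //; exact: stU.
  - move=> h [Hh ch]; split; first exact: subgroupV.
    move=> u Uu; rewrite -[LHS](actK pi h) -ch ?actKV //.
    by apply: (stU) => //; exact: subgroupV.
have NH' : H `<=` normalizer H'.
  apply: sub_normalizerP => // x h Hx [Hh ch]; split; first exact: subgroupJ.
  have Hxi := subgroupV sH Hx.
  have [c cU] := comm x Hx; have [d dU] := comm _ Hxi.
  (* The commutation scalars of [x] and of its inverse cancel. *)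
  have dc u : U u -> (d * c) *: u = u.
    move=> Uu; have Uau : U (pi a^-1%g u) by apply: (stU) => //; exact: subgroupV.
    rewrite -scalerA -{2}(actKV pi a u) -(actK pi x (pi a^-1%g u)).
    rewrite dU; last exact: stU.
    by rewrite cU // actZ actK actKV.
  move=> u Uu; rewrite conjgE !actM dU; last by do 2 apply: (stU) => //.
  rewrite ch; last exact: stU.
  rewrite cU // !actZ scalerA dc //.
  by apply: (stU) => //; apply: (stU) => //; apply: (stU) => //; exact: aU.
have stE : stable pi H' E.
  move=> h u [Hh ch] [Uu au]; split; first exact: stU.
  by rewrite /= ch // au actZ.
have fE : finite_span E by apply: finite_span_sub fU => u [].
have nzE : nonzero E by exists v0.
have [U' iU' U'E] := irreducible_exists fE sE stE nzE.
have U'U : U' `<=` U by move=> u /U'E[].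
have H'a : H' a by split.
have noniso g : H g -> iso pi H' (translate pi g U') U' -> H' g.
  move=> Hg [R LR [sub [tl _] [z1 z2]]]; have [R0 lin eqv] := LR.
  have [sU' stU' [u U'u un] _] := iU'.
  have [_ au] := U'E _ U'u; have [c cU] := comm g Hg.
  have [b Rb] := tl (pi g u) ((translateE pi g U' u).2 U'u).
  have [_ /= ab] := U'E _ (sub _ _ Rb).2.
  (* The eigenvalue is nonzero because [pi a] is invertible; it can then be cancelled to obtain
     [c = 1]. *)
  have l0 : l != 0.
    by apply: contra_neq un => l0; apply: (@act_eq0 _ _ _ pi a); rewrite au l0 scale0r.
  have Ra : R ((c * l) *: pi g u) (l *: b).
    have := eqv _ _ _ H'a Rb; rewrite ab cU; last exact: U'U.
    by rewrite au actZ scalerA.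
  have Rl : R (l *: pi g u) (l *: b).
    by have := lin l _ _ _ _ Rb R0; rewrite !addr0.
  have := linear_relationB LR Ra Rl; rewrite subrr => /z1/eqP.
  rewrite -scalerBl -{2}[l]mul1r -mulrBl scaler_eq0 mulf_eq0 (negPf l0) orbF.
  rewrite subr_eq0 => /orP[/eqP c1|/eqP/act_eq0 u0]; last by rewrite u0 eqxx in un.
  by split=> // v Uv; rewrite cU // c1 scale1r.
have [q Q] := clifford_induced sH' sH H'H NH' iU' noniso.
have iQ := clifford_irreducible sH' sH H'H NH' iU' noniso.
exists H', U', q; split=> //.
  rewrite (irreducible_eq iU iQ) in Q => //.
  apply: span_min => // v [g Hg /U'U gv]; rewrite -(actKV pi g v).
  exact: stU.
(* If [U'] were all of [U], then [a] would act on [U] as the scalar [l]. *)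
apply: contrapT => no; apply: nCa; exists l => u Uu.
have : U' u by apply: contrapT => nu; apply: no; exists u.
by move=> /U'E[].
Qed.

End CliffordStep.

Lemma finite_monomial H W : nilpotent_group G ->
  subgroup H -> irreducible pi H W -> finite_span W ->
  exists H' u p, [/\ subgroup H', u != 0 & internally_induced pi H W H' (line u) p].
Proof.
move=> nilG sH iW fW; have [sW stW _ _] := iW.
pose P n := `[< exists H' U p, [/\ subgroup H', irreducible pi H' U,
  internally_induced pi H W H' U p & ~ has_free n U] >].
(* Among all subspaces from which [W] is induced, one with the least dimension bound is taken. *)
have exP : exists n, P n.
  have [n nf] := finite_span_free fW; exists n; apply/asboolP.
  by exists H, W, id; split=> //; exact: internally_induced_refl.
case: (ex_minnP exP) => n /asboolP[H' [U [p [sH' iU Pp nf]]]] nmin.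
have fU : finite_span U.
  by apply: finite_span_sub fW; apply: subset_trans (ii_WM Pp) _.
have [sc|nsc] := pselect (forall h, H' h -> exists c, forall u, U u -> pi h u = c *: u).
  have [u un UE] := scalar_irreducible iU sc.
  by exists H', u, p; rewrite -UE.
have [H'' [U' [q [sH'' iU' Q [x Ux nU'x]]]]] := nonscalar_induced nilG sH' iU fU nsc.
case: n nf nmin => [|n] nf nmin; first by case: nf; exact: has_free0.
suff /nmin : P n by rewrite ltnn.
apply/asboolP; exists H'', U', (q \o p); split=> //.
  exact: internally_induced_trans Pp Q.
move=> f; apply: nf; have [sU' _ _ _] := iU'.
exact: has_free_proper sU' (ii_WM Q) Ux nU'x f.
Qed.

End Monomial.

(** * From internal to external induction *)

Section Bridge.
Variables (K : fieldType) (G : groupType) (V : lmodType K).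
Variable pi : representation (K := K) (G := G) predT V.
Implicit Types (H N : set G) (U W X Y Z M : set V) (g h a : G) (u v w : V).

Lemma subgroup_mem (H : groupClosed G) : subgroup [set g | g \in H].
Proof.
split=> [|x y|x] /=; [exact: gpred1|exact: gpredM|by rewrite gpredV].
Qed.

Lemma groupClosed_of_subgroup H : subgroup H ->
  exists Hc : groupClosed G, forall g, (g \in Hc) = `[< H g >].
Proof.
move=> sH; pose S : {pred G} := fun g => `[< H g >].
have S1 : 1%g \in S by apply/asboolP; exact: subgroup1.
have SM : {in S &, forall x y, (x * y)%g \in S}.
  move=> x y /asboolP Hx /asboolP Hy; apply/asboolP; exact: subgroupM.
have SV : {in S, forall x, x^-1%g \in S}.
  by move=> x /asboolP Hx; apply/asboolP; exact: subgroupV.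
pose Hc := HB.pack_for (groupClosed G) S (isMulClosed.Build G S SM)
  (isMul1Closed.Build G S S1) (isInvClosed.Build G S SV).
by exists Hc.
Qed.

Lemma irreducible_of_repr : irreducible_repr pi -> irreducible pi setT setT.
Proof.
move=> [[v0 v0n] irr]; split=> //; first by exists v0.
move=> Y sY stY _ [y Yy yn] v _.
pose S : {pred V} := fun v => `[< Y v >].
have clS : submod_closed S.
  split; first by apply/asboolP; exact: subspace0.
  move=> k u w /asboolP Yu /asboolP Yw; apply/asboolP; exact: subspaceP.
pose Sc := HB.pack_for (submodClosed V) S (GRing.isSubmodClosed.Build K V S clS).
have [|S0|SV] := irr Sc.
- by move=> g u /asboolP Yu; apply/asboolP; exact: stY.
- by move/eqP: yn; case; apply: S0; apply/asboolP.
- exact/asboolP/SV.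
Qed.

(** A homomorphism from the character is determined by its value at 1, which identifies the Hom
    space with the weight space [E]. A line in [E] serves as [W], and every copy of it carries the
    same character, hence lies in [E]. *)
Lemma finite_weight_pair_of_repr : finite_weight pi ->
  exists H W, finite_weight_pair pi H W.
Proof.
move=> [H [chi [[f fn] [n [e espan]]]]].
have [lin_f eqv_f] := asboolP _ (hom_funP f).
have [chin chi1 chiM] := characterP chi.
pose E : set V := [set v | forall h, h \in H -> pi h v = chi h *: v].
have fZ k : f k = k *: f 1.
  have := lin_f k 1 0; have := lin_f (-1) 0 0; rewrite scaler0 addr0 scaleN1r addNr.
  by move=> ->; rewrite !addr0 /GRing.scale /= mulr1.
have Ef : E (f 1).
  by move=> h Hh; have := eqv_f h Hh 1; rewrite /= /char_act mulr1 fZ => ->.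
have f1 : f 1 != 0.
  apply: contra_neq fn => f10; apply/val_inj/funext => k /=.
  by rewrite [LHS]fZ f10 scaler0.
exists [set g | g \in H], (line (f 1)); split; first exact: subgroup_mem.
  split.
  - split; first by exists 0; rewrite scale0r.
    by move=> k _ _ [a ->] [b ->]; exists (k * a + b); rewrite scalerDl scalerA.
  - move=> h _ Hh [k ->]; exists (k * chi h).
    by rewrite actZ Ef // scalerA.
  - by exists (f 1) => //; exists 1; rewrite scale1r.
  - move=> Y sY _ YL [y Yy yn] _ [k ->]; have [l yl] := YL y Yy.
    have l0 : l != 0 by apply: contra_neq yn => l0; rewrite yl l0 scale0r.
    have -> : k *: f 1 = (k / l) *: y by rewrite yl scalerA mulrVK ?unitfE.
    exact: subspaceZ.
exists E.
  exists [seq e i 1 | i : 'I_n] => v Ev.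
  pose fv (k : K^o) : V := k *: v.
  have fvP : fv \in hom_pred (char_repr chi) (res H pi).
    apply/asboolP; split=> [k a b|h Hh a] /=; first by rewrite /fv scalerDl scalerA.
    by rewrite /fv actZ Ev // scalerA mulrC.
  have [c cE] := espan (HomSpace fvP).
  have -> : v = \sum_(i < n) c i *: e i 1.
    have := congr1 (fun t => hom_fun t 1) cE; rewrite /= /fv scale1r => ->.
    have sumE m (F : 'I_m -> hom_space (char_repr chi) (res H pi)) :
        hom_fun (\sum_i F i) 1 = \sum_i F i 1.
      elim: m F => [|m IH] F; first by rewrite !big_ord0.
      by rewrite !big_ord_recl -IH.
    by rewrite sumE.
  apply: subspace_sum; first exact: subspace_span.
  move=> i; apply: subspaceZ; first exact: subspace_span.
  by apply: subset_span; rewrite /=; apply/mapP; exists i; rewrite ?mem_enum.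
move=> X [R LR [sub [tl _] [z1 z2]]] x Xx h Hh.
have [R0 lin eqv] := LR; have [y Rxy] := tl x Xx.
have [_ [k yE]] := sub _ _ Rxy.
have R1 := eqv _ _ _ Hh Rxy; have R2 := lin (chi h) _ _ _ _ Rxy R0.
have := linear_relationB LR R1 R2.
rewrite !addr0 yE actZ Ef // !scalerA mulrC subrr => /z1/eqP.
by rewrite subr_eq0 => /eqP.
Qed.

(** The isomorphism sends [v] to the function [g |-> co (pi g v)], where [co] is the coordinate
    along [u] of the projection to the line. It is injective by [ii_faithful]; surjectivity is an
    induction on the cosets in the support. *)
Lemma monomial_of_induced H u p : subgroup H -> u != 0 ->
  irreducible pi setT setT -> internally_induced pi setT setT H (line u) p ->
  monomial_repr pi.
Proof.
move=> sH un iV P; have sT := subgroupT G.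
have [Hc HcE] := groupClosed_of_subgroup sH.
have chi_ex h : exists c, H h -> pi h u = c *: u.
  have [Hh|nHh] := pselect (H h); last by exists 0.
  have [|k kE] := ii_stW P Hh (u := u); first by exists 1; rewrite scale1r.
  by exists k.
have [chi chiE] := choice chi_ex.
have scal_inj (a b : K) : a *: u = b *: u -> a = b.
  move/eqP; rewrite -subr_eq0 -scalerBl scaler_eq0 (negPf un) orbF subr_eq0.
  by move/eqP.
have chiP : is_character Hc chi.
  split.
  - move=> h; rewrite HcE => /asboolP Hh; apply: contra_neq un => c0.
    by apply: (@act_eq0 _ _ _ pi h); rewrite chiE // c0 scale0r.
  - by apply: scal_inj; rewrite -chiE ?act1 ?scale1r //; exact: subgroup1.
  - move=> g h; rewrite !HcE => /asboolP Hg /asboolP Hh; apply: scal_inj.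
    rewrite -chiE; last exact: subgroupM.
    by rewrite actM chiE // actZ chiE // scalerA mulrC.
pose chi' := Character chiP.
have [co coE] := choice (fun v => ii_in P (I : setT v)).
have coD k v w : co (k *: v + w) = k * co v + co w.
  by apply: scal_inj; rewrite -coE (ii_linear P) // !coE scalerDl scalerA.
have coH h v : H h -> co (pi h v) = chi h * co v.
  move=> Hh; apply: scal_inj; rewrite -coE (ii_equivariant P) // coE actZ chiE //.
  by rewrite !scalerA mulrC.
(* A summand of [v] in the translate of the line by [g0] contributes only where [g * g0] lies in
   [H], that is on the right coset of [g0^-1]. *)
have support v : exists s : seq G, forall g, co (pi g v) != 0 ->
    exists2 t, t \in s & (g * t^-1)%g \in Hc.
  elim: (ii_span P I : linear_span _ v) => {v} [|k v w [g0 _ g0v] _ [s sE]].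
    exists [::] => g; rewrite act0 => /eqP; case; apply: scal_inj.
    by rewrite -coE (ii_p0 P) scale0r.
  exists (g0^-1%g :: s) => g; rewrite act_linear coD => cn.
  have [Hg|nHg] := pselect (H (g * g0)%g).
    by exists g0^-1%g; [rewrite mem_head|rewrite invgK HcE; exact/asboolP].
  have c0 : co (pi g v) = 0.
    apply: scal_inj; rewrite -coE -(actKV pi g0 v) -actM (ii_out P) ?scale0r //.
  move: cn; rewrite c0 mulr0 add0r => /sE[t ts Ht].
  by exists t => //; rewrite inE ts orbT.
have phiP v : (fun g => co (pi g v) : K^o) \in ind_pred (char_repr chi').
  have [s sE] := support v; apply: (ind_predP (s := s)) => // h.
  by rewrite HcE => /asboolP Hh g; rewrite actM coH.
pose phi v : ind_space (char_repr chi') := IndSpace (phiP v).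
have phi_hom : phi \in hom_pred pi (ind (char_repr chi')).
  apply/asboolP; split=> [k v w|h _ v]; apply/val_inj/funext => g /=.
    by rewrite act_linear coD.
  by rewrite actM.
have phi_inj v w : phi v = phi w -> v = w.
  move=> /(congr1 val) /= E; apply/eqP; rewrite -subr_eq0; apply/eqP.
  apply: (ii_faithful sT P iV) => // g _.
  rewrite coE addrC -scaleN1r act_linear coD (congr1 (@^~ g) E).
  by rewrite mulN1r addNr scale0r.
have surj (s : seq G) (f : G -> K) :
    (forall h g, H h -> f (h * g)%g = chi h * f g) ->
    (forall g, f g != 0 -> exists2 t, t \in s & (g * t^-1)%g \in Hc) ->
    exists v, forall g, co (pi g v) = f g.
  elim: s f => [|t s IH] f fH fs.
    exists 0 => g; apply: scal_inj; rewrite act0 -coE (ii_p0 P).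
    have [->|/fs[]//] := eqVneq (f g) 0; by rewrite scale0r.
  (* Remove the values on the coset of [t]; they are realized by [f t *: pi t^-1 u]. *)
  pose f' g := if `[< H (g * t^-1)%g >] then 0 else f g.
  have [||v vE] := IH f'.
  - move=> h g Hh; rewrite /f' -mulgA.
    have -> : `[< H (h * (g * t^-1))%g >] = `[< H (g * t^-1)%g >].
      apply: asbool_equiv_eq; split; first exact: subgroupMl.
      exact: subgroupM.
    by case: ifP => _; [rewrite mulr0|exact: fH].
  - move=> g; rewrite /f'; case: ifP; first by rewrite eqxx.
    move=> nH /fs[t' + Ht']; rewrite inE => /orP[/eqP tt|]; last by exists t'.
    by rewrite tt HcE nH in Ht'.
  exists (f t *: pi t^-1%g u + v) => g; rewrite act_linear coD vE -actM /f'.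
  have co1 : co u = 1.
    by apply: scal_inj; rewrite -coE scale1r (ii_id P) //; exists 1; rewrite scale1r.
  case: asboolP => Hg; last first.
    rewrite (_ : co _ = 0) ?mulr0 ?add0r //; apply: scal_inj.
    by rewrite -coE (ii_out P) ?scale0r //; exists 1; rewrite scale1r.
  by rewrite coH // co1 mulr1 addr0 mulrC -fH // mulgVK.
have phi_surj (f : ind_space (char_repr chi')) : exists v, phi v = f.
  have /asboolP[fH [s sE]] := ind_funP f.
  have [||v vE] := surj s f.
  - by move=> h g Hh; apply: fH; rewrite HcE; exact/asboolP.
  - by move=> g /sE.
  by exists v; apply/val_inj/funext => g /=; rewrite vE.
exists Hc, chi'; exists (HomSpace phi_hom).
have [psi psiE] := choice phi_surj.
exists psi => [v|f]; last exact: psiE.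
by apply: phi_inj; rewrite psiE.
Qed.

End Bridge.

Theorem theorem4p4 (K : closedFieldType) (G : groupType) (V : lmodType K)
    (pi : representation (K := K) (G := G) predT V) :
  finitely_generated G -> nilpotent_group G ->
  irreducible_repr pi -> finite_weight pi -> monomial_repr pi.
Proof.
move=> fgG nilG /irreducible_of_repr iV /finite_weight_pair_of_repr[H0 [W0 fw0]].
have noeG := nilpotent_noetherian nilG fgG.
have [||H [W fwHW] maxH] :=
  @noetherian_max _ [set H | exists W, finite_weight_pair pi H W] noeG.
- by move=> H [W []].
- by exists H0, W0.
have maxH' H' W' : finite_weight_pair pi H' W' -> H `<=` H' -> H' `<=` H.
  by move=> fw'; apply: maxH; exists W'.
have [p P] := induced_from_maximal nilG noeG fwHW maxH' iV.
have [sH iW _] := fwHW.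
have [L [u [q [sL un Q]]]] :=
  finite_monomial nilG sH iW (finite_weight_span fwHW).
exact: monomial_of_induced sL un iV (internally_induced_trans (subgroupT G) P Q).
Qed.
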